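(* Suppose the DAE $\dot q=f(q,u)$, $0=\phi(q,u)$ on $M_d\times M_a$, with $\dim M_a\ge 1$, has index $\nu=1$, i.e., for each $(q,u)\in M_d\times M_a$ such that $\phi(q,u)=0$, the matrix $\left(\partial\phi^A(q,u)/\partial u^a\right)_{A,a}$ is invertible. Then the presymplectic constraint algorithm applied to the associated adjoint DAE system, i.e. to the presymplectic manifold $(\overline{T^*M}_d\oplus\Phi^*,\Omega_0)$ with Hamiltonian $H(q,u,p,\lambda)=\langle p,f(q,u)\rangle+\langle\lambda,\phi(q,u)\rangle$, terminates after one step: $P_2=P_1$ and $\nu_P=\nu=1$.
   Context: All manifolds and maps are smooth. $M_d$, $M_a$ are manifolds with local coordinates $(q,u)=(q^i,u^a)$ on $M_d\times M_a$, and $\Phi\to M_d\times M_a$ is a vector bundle. With $\pi_d:M_d\times M_a\to M_d$ the projection, $\overline{TM}_d=\pi_d^*(TM_d)$ and $\overline{T^*M}_d=\pi_d^*(T^*M_d)$ are pullback bundles over $M_d\times M_a$. The DAE is specified by sections $f\in\Gamma(\overline{TM}_d)$ and $\phi\in\Gamma(\Phi)$; $\phi^A$ are the components of $\phi$ in a local trivialization. $\Phi^*$ is the dual bundle and $\overline{T^*M}_d\oplus\Phi^*$ is the Whitney sum over $M_d\times M_a$, with coordinates $(q,u,p,\lambda)$. $\Omega_0$ is the pullback to $\overline{T^*M}_d\oplus\Phi^*$ of the canonical symplectic form of $T^*M_d$ along $\overline{T^*M}_d\oplus\Phi^*\to\overline{T^*M}_d\to T^*M_d$; in coordinates $\Omega_0=dq^i\wedge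 dp_i$. Presymplectic constraint algorithm: for a presymplectic manifold $(P,\Omega)$ ($\Omega$ closed of constant rank) and $H:P\to\mathbb R$, set $P_0=P$, $\Omega_0=\Omega$, $H_0=H$, and define recursively $P_{k+1}=\{p\in P_k: Z_p(H_k)=0\text{ for all }Z\in\ker(\Omega_k)\}$, $\Omega_{k+1}=\Omega_k|_{P_{k+1}}$, $H_{k+1}=H_k|_{P_{k+1}}$ (pullbacks to $P_{k+1}$, assumed to be a submanifold). $\nu_P$ denotes the minimum integer such that $P_{\nu_P}=P_{\nu_P+1}$. *)

(* Defs.v *)
From mathcomp Require Import all_boot all_order all_algebra.
From mathcomp Require Import all_classical all_reals all_analysis.

Set Implicit Arguments.
Unset Strict Implicit.
Unset Printing Implicit Defensive.

Import Order.TTheory GRing.Theory Num.Theory.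
Import numFieldNormedType.Exports.

Local Open Scope classical_set_scope.
Local Open Scope ring_scope.

(** * Smoothness in normed modules *)

(* C^k on D. It is used with D open in a finite-dimensional V, where having a
   differential and C^k directional derivatives is the usual C^(k+1). *)
Fixpoint Ck (R : realType) (k : nat) (V W : normedModType R) (D : set V)
    (g : V -> W) : Prop :=
  match k with
  | 0 => forall x, D x -> {for x, continuous g}
  | k'.+1 => (forall x, D x -> differentiable g x)
             /\ forall v : V, Ck k' D (fun x => 'D_v g x : W)
  end.

Definition smooth_on (R : realType) (V W : normedModType R) (D : set V)
    (g : V -> W) : Prop := forall k, Ck k D g.

(** * Smooth manifolds *)

(* A set with an R^n-valued atlas. [param i] is the inverse of the chart
   [chart i], whose domain is [dom i]; [chart_at x] is a chosen chart around x,
   with respect to which tangent vectors at x are written. The axioms are in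
   [is_manifold]. *)
Record charted_space (R : realType) (n : nat) := ChartedSpace {
  point :> Type;
  chart_ix : Type;
  dom : chart_ix -> set point;
  chart : chart_ix -> point -> 'rV[R]_n;
  param : chart_ix -> 'rV[R]_n -> point;
  chart_at : point -> chart_ix }.

Arguments dom {R n c}.
Arguments chart {R n c}.
Arguments param {R n c}.
Arguments chart_at {R n c}.

(* Open sets of the topology induced by the atlas. *)
Definition mopen (R : realType) (n : nat) (M : charted_space R n)
    (U : set M) : Prop :=
  forall i : chart_ix M, open (chart i @` (dom i `&` U)).

(* A smooth n-manifold without boundary, Hausdorff and second countable (i.e.
   covered by countably many chart domains). *)
Definition is_manifold (R : realType) (n : nat) (M : charted_space R n) :
    Prop :=
  [/\ forall x : M, dom (chart_at x) x,
      forall (i : chart_ix M) (x : M), dom i x -> param i (chart i x) = x,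
      forall i j : chart_ix M,
        open (chart i @` (dom i `&` dom j)) /\
        smooth_on (chart i @` (dom i `&` dom j)) (chart j \o param i),
      forall x y : M, x <> y -> exists U V : set M,
        [/\ mopen U, mopen V, U x, V y & U `&` V = set0]
    & exists I : set (chart_ix M), countable I /\
        forall x : M, exists2 i, I i & dom i x].

Definition prod_space (R : realType) (n m : nat) (M : charted_space R n)
    (N : charted_space R m) : charted_space R (n + m) :=
  @ChartedSpace R (n + m) (M * N)%type (chart_ix M * chart_ix N)%type
    (fun i x => dom i.1 x.1 /\ dom i.2 x.2)
    (fun i x => row_mx (chart i.1 x.1) (chart i.2 x.2))
    (fun i y => (param i.1 (lsubmx y), param i.2 (rsubmx y)))
    (fun x => (chart_at x.1, chart_at x.2)).

(* T_x M is the model space R^n, a vector being identified with its components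
   in the chart [chart_at x]; components in any other chart are obtained from
   [triv (tangent_bundle M)] below. *)
Definition tangent_space (R : realType) (n : nat) (M : charted_space R n)
    (x : M) : vectType R := 'rV[R]_n.

(* The differential T_x M -> T_(g x) N of g. *)
Definition mdiff (R : realType) (n m : nat) (M : charted_space R n)
    (N : charted_space R m) (g : M -> N) (x : M) (v : tangent_space x) :
    tangent_space (g x) :=
  'd (chart (chart_at (g x)) \o g \o param (chart_at x) :
        'rV[R]_n -> 'rV[R]_m) (chart (chart_at x) x) v.

Arguments mdiff {R n m M N}.

(* The derivative Z(H) of a function along a tangent vector. *)
Definition dfun (R : realType) (n : nat) (M : charted_space R n)
    (H : M -> R) (x : M) (Z : tangent_space x) : R :=
  'd (H \o param (chart_at x) : 'rV[R]_n -> R^o) (chart (chart_at x) x) Z.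

Arguments dfun {R n M}.

(** * Vector bundles *)

(* A rank-r vector bundle over B, given by its fibers and its local
   trivializations [triv j x : fiber x -> R^r] for x in [tdom j]; the smooth
   structure of the total space is the one they determine, see [total_space].
   [triv_at x] is a chosen local trivialization around x. *)
Record bundle (R : realType) (n : nat) (B : charted_space R n) (r : nat) :=
  Bundle {
    fiber : B -> vectType R;
    triv_ix : Type;
    tdom : triv_ix -> set B;
    triv : triv_ix -> forall x : B, 'Hom(fiber x, 'rV[R]_r);
    triv_at : B -> triv_ix }.

Arguments fiber {R n B r}.
Arguments triv_ix {R n B r}.
Arguments tdom {R n B r}.
Arguments triv {R n B r}.
Arguments triv_at {R n B r}.

Definition is_vbundle (R : realType) (n : nat) (B : charted_space R n)
    (r : nat) (E : bundle B r) : Prop :=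
  [/\ forall x : B, tdom E (triv_at E x) x,
      forall j : triv_ix E, mopen (tdom E j),
      forall (j : triv_ix E) (x : B), tdom E j x -> bijective (triv E j x)
    & forall (i : chart_ix B) (j k : triv_ix E) (v : 'rV[R]_r),
        smooth_on (chart i @` (dom i `&` (tdom E j `&` tdom E k)))
          (fun y => triv E k (param i y) (((triv E j (param i y))^-1)%VF v))].

Definition section (R : realType) (n : nat) (B : charted_space R n) (r : nat)
    (E : bundle B r) : Type := forall x : B, fiber E x.

Definition smooth_section (R : realType) (n : nat) (B : charted_space R n)
    (r : nat) (E : bundle B r) (s : section E) : Prop :=
  forall (i : chart_ix B) (j : triv_ix E),
    smooth_on (chart i @` (dom i `&` tdom E j))
      (fun y => triv E j (param i y) (s (param i y))).

Definition tangent_bundle (R : realType) (n : nat) (M : charted_space R n) :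
    bundle M n :=
  @Bundle R n M n (@tangent_space R n M) (chart_ix M) (@dom R n M)
    (fun i x =>
       linfun ('d (chart i \o param (chart_at x) : 'rV[R]_n -> 'rV[R]_n)
                 (chart (chart_at x) x)))
    chart_at.

Definition dual_bundle (R : realType) (n : nat) (B : charted_space R n)
    (r : nat) (E : bundle B r) : bundle B r :=
  @Bundle R n B r (fun x => 'Hom(fiber E x, R^o)) (triv_ix E) (tdom E)
    (fun j x => linfun (fun l : 'Hom(fiber E x, R^o) =>
       \row_(A < r) (l (((triv E j x)^-1)%VF (delta_mx 0 A)) : R)))
    (triv_at E).

Definition pullback_bundle (R : realType) (n m : nat) (B' : charted_space R m)
    (B : charted_space R n) (r : nat) (g : B' -> B) (E : bundle B r) :
    bundle B' r :=
  @Bundle R m B' r (fun x => fiber E (g x)) (triv_ix E)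
    (fun j => g @^-1` tdom E j) (fun j x => triv E j (g x))
    (fun x => triv_at E (g x)).

Definition whitney_sum (R : realType) (n : nat) (B : charted_space R n)
    (r s : nat) (E : bundle B r) (F : bundle B s) : bundle B (r + s) :=
  @Bundle R n B (r + s) (fun x => (fiber E x * fiber F x)%type)
    (triv_ix E * triv_ix F)%type (fun j => tdom E j.1 `&` tdom F j.2)
    (fun j x => linfun (fun e : fiber E x * fiber F x =>
       row_mx (triv E j.1 x e.1) (triv F j.2 x e.2)))
    (fun x => (triv_at E x, triv_at F x)).

(* The charts are (base coordinates, fiber coordinates). *)
Definition total_space (R : realType) (n : nat) (B : charted_space R n)
    (r : nat) (E : bundle B r) : charted_space R (n + r) :=
  @ChartedSpace R (n + r) {x : B & fiber E x} (chart_ix B * triv_ix E)%type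
    (fun i z => dom i.1 (projT1 z) /\ tdom E i.2 (projT1 z))
    (fun i z => row_mx (chart i.1 (projT1 z)) (triv E i.2 _ (projT2 z)))
    (fun i y => existT (fiber E) (param i.1 (lsubmx y))
       (((triv E i.2 (param i.1 (lsubmx y)))^-1)%VF (rsubmx y)))
    (fun z => (chart_at (projT1 z), triv_at E (projT1 z))).

(** * The presymplectic constraint algorithm *)

(* The bare data; bilinearity, antisymmetry, smoothness and closedness are not
   part of the type. *)
Definition two_form (R : realType) (n : nat) (P : charted_space R n) : Type :=
  forall z : P, tangent_space z -> tangent_space z -> R.

Definition pullback_form (R : realType) (n m : nat) (M : charted_space R n)
    (N : charted_space R m) (g : M -> N) (w : two_form N) : two_form M :=
  fun z Z W => w (g z) (mdiff g z Z) (mdiff g z W).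

(* S is a embedded submanifold: near
   each of its points it is the zero set of a submersion to R^c. *)
Definition embedded_submanifold (R : realType) (n : nat)
    (P : charted_space R n) (S : set P) : Prop :=
  exists c : nat, forall z : P, S z ->
    exists (O : set 'rV[R]_n) (F : 'rV[R]_n -> 'rV[R]_c),
      [/\ open O,
          O (chart (chart_at z) z)
          /\ O `<=` chart (chart_at z) @` dom (chart_at z),
          smooth_on O F,
          forall y, O y -> forall w, exists v, 'd F y v = w
        & forall y, O y -> (S (param (chart_at z) y) <-> F y = 0)].

(* T_z S: the velocities at z of smooth curves of P that lie in S. *)
Definition tangent_to (R : realType) (n : nat) (P : charted_space R n)
    (S : set P) (z : P) : set (tangent_space z) :=
  [set v | exists (gam : R -> P) (e : R),
    let c : R^o -> 'rV[R]_n := chart (chart_at z) \o gam in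
    [/\ 0 < e, gam 0 = z,
        forall t, `|t| < e -> dom (chart_at z) (gam t) /\ S (gam t),
        smooth_on [set t : R^o | `|t| < e] c
      & 'D_1 c 0 = v]].

Arguments tangent_to {R n P}.

(* The kernel at z of the pullback of w to S. *)
Definition ker_form (R : realType) (n : nat) (P : charted_space R n)
    (w : two_form P) (S : set P) (z : P) : set (tangent_space z) :=
  [set Z | tangent_to S z Z /\ forall W, tangent_to S z W -> w z Z W = 0].

Arguments ker_form {R n P}.

(* The sets P_k. A vector Z in ker (Omega_k) is tangent to P_k, so that the
   derivative Z(H_k) of H_k = H|P_k is Z(H). *)
Fixpoint constraint_set (R : realType) (n : nat) (P : charted_space R n)
    (w : two_form P) (H : P -> R) (k : nat) : set P :=
  match k with
  | 0 => setT
  | k'.+1 => [set z | constraint_set w H k' z /\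
       forall Z, ker_form w (constraint_set w H k') z Z -> dfun H z Z = 0]
  end.

(* nu is the least integer with P_nu = P_(nu+1). *)
Definition is_nuP (R : realType) (n : nat) (P : charted_space R n)
    (w : two_form P) (H : P -> R) (nu : nat) : Prop :=
  constraint_set w H nu = constraint_set w H nu.+1 /\
  forall k, (k < nu)%N -> constraint_set w H k <> constraint_set w H k.+1.

(** * The adjoint DAE system *)

Definition cotangent_manifold (R : realType) (n : nat)
    (M : charted_space R n) : charted_space R (n + n) :=
  total_space (dual_bundle (tangent_bundle M)).

(* dq^i /\ dp_i; at (q, p) the chosen chart of T^*M is the canonical chart
   (q^i, p_i) that comes from the chart [chart_at q] of M. *)
Definition canonical_form (R : realType) (n : nat) (M : charted_space R n) :
    two_form (cotangent_manifold M) :=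
  fun z (Z W : 'rV[R]_(n + n)) =>
    \sum_(i < n) (lsubmx Z 0 i * rsubmx W 0 i - lsubmx W 0 i * rsubmx Z 0 i).

Definition proj_d (R : realType) (n m : nat) (Md : charted_space R n)
    (Ma : charted_space R m) (x : prod_space Md Ma) : Md := x.1.

Definition pulled_tangent (R : realType) (n m : nat) (Md : charted_space R n)
    (Ma : charted_space R m) : bundle (prod_space Md Ma) n :=
  pullback_bundle (@proj_d R n m Md Ma) (tangent_bundle Md).

Definition pulled_cotangent (R : realType) (n m : nat) (Md : charted_space R n)
    (Ma : charted_space R m) : bundle (prod_space Md Ma) n :=
  pullback_bundle (@proj_d R n m Md Ma) (dual_bundle (tangent_bundle Md)).

Definition adjoint_space (R : realType) (n m r : nat) (Md : charted_space R n)
    (Ma : charted_space R m) (Phi : bundle (prod_space Md Ma) r) :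
    charted_space R (n + m + (n + r)) :=
  total_space (whitney_sum (pulled_cotangent Md Ma) (dual_bundle Phi)).

(* (q, u, p, lambda) |-> (q, p) *)
Definition to_cotangent (R : realType) (n m r : nat) (Md : charted_space R n)
    (Ma : charted_space R m) (Phi : bundle (prod_space Md Ma) r)
    (z : adjoint_space Phi) : cotangent_manifold Md :=
  existT (fiber (dual_bundle (tangent_bundle Md)))
    (proj_d (projT1 z)) (projT2 z).1.

Definition Omega0 (R : realType) (n m r : nat) (Md : charted_space R n)
    (Ma : charted_space R m) (Phi : bundle (prod_space Md Ma) r) :
    two_form (adjoint_space Phi) :=
  pullback_form (@to_cotangent R n m r Md Ma Phi) (@canonical_form R n Md).

Arguments Omega0 {R n m r Md Ma} Phi.

Definition adjoint_hamiltonian (R : realType) (n m r : nat)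
    (Md : charted_space R n) (Ma : charted_space R m)
    (Phi : bundle (prod_space Md Ma) r)
    (f : section (pulled_tangent Md Ma)) (phi : section Phi)
    (z : adjoint_space Phi) : R :=
  ((projT2 z).1 : 'Hom(_, R^o)) (f (projT1 z)) +
  ((projT2 z).2 : 'Hom(_, R^o)) (phi (projT1 z)).

(* (d phi^A / d u^a)_(A, a) at x, in the charts i.1 of M_d and i.2 of M_a and
   the local trivialization j of Phi. *)
Definition constraint_jacobian (R : realType) (n m r : nat)
    (Md : charted_space R n) (Ma : charted_space R m)
    (Phi : bundle (prod_space Md Ma) r)
    (phi : section Phi)
    (i : chart_ix (prod_space Md Ma)) (j : triv_ix Phi)
    (x : prod_space Md Ma) : 'M[R]_(r, m) :=
  \matrix_(A < r, a < m)
    'D_(row_mx 0 (delta_mx 0 a))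
      (fun y : 'rV[R]_(n + m) =>
         triv Phi j (param i y) (phi (param i y)) 0 A : R^o) (chart i x).

(* The rank r of Phi is not assumed to be dim M_a: invertibility, i.e. having a
   two-sided inverse, forces r = m wherever phi vanishes. *)
Definition index_one (R : realType) (n m r : nat) (Md : charted_space R n)
    (Ma : charted_space R m) (Phi : bundle (prod_space Md Ma) r)
    (phi : section Phi) : Prop :=
  forall x : prod_space Md Ma, phi x = 0 ->
  forall (i : chart_ix (prod_space Md Ma)) (j : triv_ix Phi),
    dom i x -> tdom Phi j x ->
    exists B : 'M[R]_(m, r),
      constraint_jacobian phi i j x *m B = 1%:M /\
      B *m constraint_jacobian phi i j x = 1%:M.

(* Main.v *)
Require Import Defs.
From HB Require Import structures.
From mathcomp Require Import all_boot all_order all_algebra.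
From mathcomp Require Import all_classical all_reals all_analysis.
From mathcomp Require Import ring lra.

(* In the chart (q, u, p, lambda) the kernel of Omega_0 is spanned by the
   u- and lambda-directions, so that P_1 is the zero set of
   K = (phi, d_u (<p, f> + <lambda, phi>)).  If the Jacobian J of phi in u is
   invertible, the derivative of K in (u, lambda) is block triangular with
   diagonal blocks J and J^T: hence K is a submersion near P_1, and ker dK
   projects onto the (q, p)-space.  By an implicit function theorem every
   vector of ker dK is the velocity of a smooth curve in P_1, so a vector in the
   kernel of the restriction of Omega_0 to P_1 has no q- and p-components.
   It therefore lies in ker Omega_0 already, and H is stationary along it:
   P_2 = P_1.

   The curves come from the contraction s |-> s - K (y0 + t v + s B), where B is
   a right inverse of dK at y0; smoothness is bootstrapped from the differential
   equation that the fixed point satisfies in t.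

   The set P_k is defined with the chart chosen at each point, whereas the
   submanifold condition and the curves need a single chart around the
   point; the equation K = 0 is therefore shown not to depend on the chart and
   on the trivialization. *)

Set Implicit Arguments.
Unset Strict Implicit.
Unset Printing Implicit Defensive.

Import Order.TTheory GRing.Theory Num.Theory.
Import numFieldNormedType.Exports.

Local Open Scope classical_set_scope.
Local Open Scope ring_scope.

(** * Differential calculus *)

Section Differentials.
Context {R : realType}.
Implicit Types V W : normedModType R.

(** The first-order expansion of [g] at [x] is also one of [h], and expansions are unique. This lets
    a map be replaced by its coordinate expression near a point. *)
Lemma near_eq_differentiable V W (g h : V -> W) (x : V) :
  {near x, g =1 h} -> differentiable g x ->
  differentiable h x /\ 'd h x = 'd g x :> (V -> W).
Proof.
move=> gh dg.
have cg : continuous ('d g x) by exact: diff_continuous.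
have hE : h \o shift x = cst (h x) + 'd g x +o_ 0 id.
  have /diff_locally /eqaddoP dgE := dg; apply/eqaddoP => e e0.
  have gh0 : \forall y \near (0 : V), g (y + x) = h (y + x).
    by move: gh => /nbhs0P; apply: filterS => y; rewrite addrC.
  apply: filterS2 gh0 (dgE e e0) => y gyh.
  by rewrite !fctE /= gyh -(nbhs_singleton gh).
have dE := diff_unique cg hE.
split; last exact: dE.
by apply/diff_locallyP; rewrite dE.
Unshelve. all: by end_near. Qed.

(** Linearity is taken as a proof about a bare function, which suits maps assembled from row blocks.
    Continuity comes from writing [L] as a finite combination of coordinate functions. *)
Lemma linear_rV_differentiable n W (L : 'rV[R]_n -> W) (x : 'rV[R]_n) :
  linear L -> differentiable L x /\ 'd L x = L :> ('rV[R]_n -> W).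
Proof.
move=> linL.
pose LM := GRing.isLinear.Build _ _ _ _ L linL.
pose F : {linear 'rV[R]_n -> W} := HB.pack L LM.
have cF : continuous F.
  move=> y; apply: differentiable_continuous.
  have -> : (F : _ -> _) =
      \sum_(i < n) (fun z : 'rV[R]_n => (z 0 i : R) *: F (delta_mx 0 i)).
    apply/funext => z; rewrite fct_sumE {1}(row_sum_delta z) linear_sum.
    by apply: eq_bigr => i _; rewrite linearZ.
  by apply: differentiable_sum => i; apply/differentiableZl/differentiable_coord.
by rewrite -[L]/(F : _ -> _); split;
  [exact: linear_differentiable|exact: diff_lin].
Qed.

Lemma derive_linear n W (L : 'rV[R]_n -> W) (x v : 'rV[R]_n) :
  linear L -> 'D_v L x = L v.
Proof.
by move=> /(linear_rV_differentiable x)[dL dE]; rewrite deriveE // dE.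
Qed.

Lemma differentiable_rVP V n (g : V -> 'rV[R]_n) x :
  differentiable g x <-> forall i, differentiable (fun y => g y 0 i : R^o) x.
Proof.
split=> [dg i|dg].
  apply: (@differentiable_comp _ _ _ _ g (fun y : 'rV[R]_n => y 0 i : R^o)) => //.
  exact: differentiable_coord.
have -> : g = \sum_(i < n) (fun y => (g y 0 i : R) *: delta_mx 0 i).
  by apply/funext => y; rewrite fct_sumE {1}(row_sum_delta (g y)).
by apply: differentiable_sum => i; exact: differentiableZl.
Qed.

Lemma derive_coord V n (g : V -> 'rV[R]_n) x v i : differentiable g x ->
  ('D_v g x) 0 i = 'D_v (fun y => g y 0 i : R^o) x.
Proof. by move=> /diff_derivable dg; rewrite derive_mx // mxE. Qed.

Lemma derive_comp V W W' (h : V -> W) (g : W -> W') (x v : V) :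
  differentiable h x -> differentiable g (h x) ->
  'D_v (fun y => g (h y)) x = 'd g (h x) ('D_v h x).
Proof.
move=> dh dg; rewrite (deriveE _ dh) -[LHS]/('D_v (g \o h) x) deriveE.
  by rewrite diff_comp.
exact: differentiable_comp.
Qed.

Lemma diff_rV_sum n W (g : 'rV[R]_n -> W) x v : differentiable g x ->
  'd g x v = \sum_(i < n) (v 0 i : R) *: 'D_(delta_mx 0 i) g x.
Proof.
move=> dg; rewrite {1}(row_sum_delta v) linear_sum; apply: eq_bigr => i _.
by rewrite linearZ deriveE.
Qed.

End Differentials.

(** * Closure properties of C^k maps *)

Section CkCalculus.
Context {R : realType}.
Implicit Types (V W : normedModType R) (k : nat).

Lemma Ck_subset V W (D E : set V) (g : V -> W) k :
  E `<=` D -> Ck k D g -> Ck k E g.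
Proof.
move=> ED; elim: k g => [|k IH] g /=; first by move=> cg x /ED; exact: cg.
by move=> [dg Dg]; split=> [x /ED|v]; [exact: dg|apply: IH; exact: Dg].
Qed.

Lemma near_open_eq V (T : Type) (D : set V) (g h : V -> T) x : open D -> D x ->
  (forall y, D y -> g y = h y) -> {near x, g =1 h}.
Proof.
by move=> oD Dx gh; have := open_nbhs_nbhs (conj oD Dx); apply: filterS.
Qed.

Lemma Ck_eq V W (D : set V) (g h : V -> W) k : open D ->
  (forall x, D x -> g x = h x) -> Ck k D g -> Ck k D h.
Proof.
move=> oD; elim: k g h => [|k IH] g h gh /=.
  move=> cg x Dx; have nxgh := near_open_eq oD Dx gh.
  rewrite /prop_for /continuous_at -gh //.
  by apply: cvg_trans (cg x Dx); apply: near_eq_cvg.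
move=> [dg Dg]; split=> [x Dx|v].
  by have [] := near_eq_differentiable (near_open_eq oD Dx gh) (dg x Dx).
apply: IH (Dg v) => x Dx; apply: near_eq_derive.
exact: near_open_eq gh.
Qed.

Lemma Ck_cont V W (D : set V) (g : V -> W) k x :
  Ck k D g -> D x -> {for x, continuous g}.
Proof.
case: k => [|k] /=; first by move=> cg Dx; exact: cg.
by move=> [dg _] Dx; apply: differentiable_continuous; exact: dg.
Qed.

Lemma Ck_diff V W (D : set V) (g : V -> W) k x :
  Ck k.+1 D g -> D x -> differentiable g x.
Proof. by move=> /= [dg _]; exact: dg. Qed.

Lemma CkW V W (D : set V) (g : V -> W) k : Ck k.+1 D g -> Ck k D g.
Proof.
elim: k g => [|k IH] g /=.
  by move=> [dg _] x Dx; apply: differentiable_continuous; exact: dg.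
by move=> [dg Dg]; split=> // v; apply: IH; exact: Dg.
Qed.

Lemma Ck_cst V W (D : set V) (w : W) k : Ck k D (cst w).
Proof.
elim: k w => [|k IH] w /=; first by move=> x _; exact: cvg_cst.
split=> [x _|v]; first exact: differentiable_cst.
have -> : (fun x => 'D_v (cst w) x : W) = cst 0.
  by apply/funext => x; rewrite derive_cst.
exact: IH.
Qed.

Lemma Ck_add V W (D : set V) (g h : V -> W) k : open D ->
  Ck k D g -> Ck k D h -> Ck k D (fun x => g x + h x).
Proof.
move=> oD; elim: k g h => [|k IH] g h /=.
  by move=> cg ch x Dx; apply: continuousD; [exact: cg|exact: ch].
move=> [dg Dg] [dh Dh]; split=> [x Dx|v].
  by apply: differentiableD; [exact: dg|exact: dh].
apply: Ck_eq (IH _ _ (Dg v) (Dh v)) => // x Dx.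
rewrite -[RHS]/('D_v (g + h) x) deriveD //; apply: diff_derivable;
  [exact: dg|exact: dh].
Qed.

Lemma Ck_sum V W (D : set V) (I : finType) (g : I -> V -> W) k : open D ->
  (forall i, Ck k D (g i)) -> Ck k D (fun x => \sum_i g i x).
Proof.
move=> oD Cg.
have : forall s : seq I, Ck k D (fun x => \sum_(i <- s) g i x); last exact.
elim=> [|i s IH].
  by apply: Ck_eq (Ck_cst D (0 : W) k) => // x _; rewrite big_nil.
by apply: Ck_eq (Ck_add oD (Cg i) IH) => // x _; rewrite big_cons.
Qed.

Lemma Ck_mul V (D : set V) (g h : V -> R^o) k : open D ->
  Ck k D g -> Ck k D h -> Ck k D (fun x => g x * h x : R^o).
Proof.
move=> oD; elim: k g h => [|k IH] g h Cg Ch.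
  move=> x Dx; apply: continuousM; [exact: Ck_cont Cg Dx|exact: Ck_cont Ch Dx].
have [dg Dg] := Cg; have [dh Dh] := Ch.
split=> [x Dx|v].
  by apply: (@differentiableM _ _ g h); [exact: dg|exact: dh].
have C1 := IH _ _ (CkW Cg) (Dh v); have C2 := IH _ _ (CkW Ch) (Dg v).
apply: Ck_eq (Ck_add oD C1 C2) => // x Dx.
rewrite -[RHS]/('D_v (g * h) x) deriveM //; apply: diff_derivable;
  [exact: dg|exact: dh].
Qed.

Lemma Ck_prod V (D : set V) (I : finType) (g : I -> V -> R^o) k : open D ->
  (forall i, Ck k D (g i)) -> Ck k D (fun x => \prod_i g i x : R^o).
Proof.
move=> oD Cg.
have : forall s : seq I, Ck k D (fun x => \prod_(i <- s) g i x : R^o); last exact.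
elim=> [|i s IH].
  by apply: Ck_eq (Ck_cst D (1 : R^o) k) => // x _; rewrite big_nil.
by apply: Ck_eq (Ck_mul oD (Cg i) IH) => // x _; rewrite big_cons.
Qed.

(** The induction rests on D(1/g) = -(1/g)^2 D g, where 1/g occurs with one order of smoothness
    less. *)
Lemma Ck_inv V (D : set V) (g : V -> R^o) k : open D ->
  (forall x, D x -> g x != 0) -> Ck k D g -> Ck k D (fun x => (g x)^-1 : R^o).
Proof.
move=> oD g0; elim: k => [|k IH] Cg.
  by move=> x Dx; apply: continuousV (Ck_cont Cg Dx); exact: g0.
have [dg Dg] := Cg; have Ci := IH (CkW Cg).
split=> [x Dx|v]; first by apply: (@differentiableV _ _ g); [exact: dg|exact: g0].
have := Ck_mul oD (Ck_mul oD Ci Ci) (Ck_mul oD (Ck_cst D (-1 : R^o) k) (Dg v)).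
apply: Ck_eq => // x Dx.
rewrite -[RHS]/('D_v (fun y => (g y)^-1) x) deriveV; last 2 first.
- exact: g0.
- by apply: diff_derivable; exact: dg.
by rewrite /cst mulN1r mulrN expr2 invfM scaleNr.
Qed.

Lemma Ck_rVP V n (D : set V) (g : V -> 'rV[R]_n) k : open D ->
  Ck k D g <-> forall i, Ck k D (fun x => g x 0 i : R^o).
Proof.
move=> oD; split.
  elim: k g => [|k IH] g /=.
    move=> cg i x Dx.
    apply: (@continuous_comp _ _ _ g (fun y : 'rV[R]_n => y 0 i : R^o)).
      exact: cg.
    exact: coord_continuous.
  move=> [dg Dg] i; split=> [x Dx|v].
    exact: (differentiable_rVP g x).1 (dg x Dx) i.
  by apply: Ck_eq (IH _ (Dg v) i) => // x Dx; exact/derive_coord/dg.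
elim: k g => [|k IH] g Cg.
  pose c (i : 'I_n) (y : V) : 'rV[R]_n := (g y 0 i : R) *: delta_mx 0 i.
  have : Ck 0 D (fun y => \sum_i c i y).
    by apply: Ck_sum => // i x Dx; apply: continuousZr_tmp; exact: Cg.
  by apply: Ck_eq => // y _; rewrite [RHS](row_sum_delta (g y)).
have dg x : D x -> differentiable g x.
  by move=> Dx; apply/differentiable_rVP => i; exact: Ck_diff (Cg i) Dx.
split=> // v; apply: IH => i.
by apply: Ck_eq ((Cg i).2 v) => // x Dx; exact/esym/derive_coord/dg.
Qed.

Lemma Ck_linear n W (D : set 'rV[R]_n) (L : 'rV[R]_n -> W) k :
  linear L -> Ck k D L.
Proof.
move=> linL; case: k => [|k] /=.
  move=> x _; apply: differentiable_continuous.
  by have [] := linear_rV_differentiable x linL.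
split=> [x _|v]; first by have [] := linear_rV_differentiable x linL.
have -> : (fun x => 'D_v L x : W) = cst (L v).
  by apply/funext => x; rewrite derive_linear.
exact: Ck_cst.
Qed.

(** The chain rule is expanded in the partial derivatives of [g], so that the induction closes with
    sums and products of scalar functions. *)
Lemma Ck_comp V n (D : set V) (E : set 'rV[R]_n) (h : V -> 'rV[R]_n)
    (g : 'rV[R]_n -> R^o) k : open D -> (forall x, D x -> E (h x)) ->
  Ck k D h -> Ck k E g -> Ck k D (fun x => g (h x)).
Proof.
move=> oD hE; elim: k g => [|k IH] g Ch Cg.
  move=> x Dx.
  apply: (@continuous_comp _ _ _ h g); [exact: Ck_cont Ch Dx|].
  exact: Ck_cont Cg (hE x Dx).
have [dh Dh] := Ch; have [dg Dg] := Cg.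
split=> [x Dx|v].
  by apply: (@differentiable_comp _ _ _ _ h g); [exact: dh|exact/dg/hE].
have : Ck k D (fun x => \sum_(i < n)
    ('D_v h x 0 i * 'D_(delta_mx 0 i) g (h x) : R^o)).
  apply: Ck_sum => // i; apply: Ck_mul => //.
    exact: (Ck_rVP _ _ oD).1 (Dh v) i.
  exact: IH (CkW Ch) (Dg _).
apply: Ck_eq => // x Dx.
rewrite [RHS]derive_comp ?diff_rV_sum //; by [exact: dg (hE x Dx)|exact: dh].
Qed.

Lemma Ck_comp_rV V n p (D : set V) (E : set 'rV[R]_n) (h : V -> 'rV[R]_n)
    (g : 'rV[R]_n -> 'rV[R]_p) k : open D -> open E ->
  (forall x, D x -> E (h x)) ->
  Ck k D h -> Ck k E g -> Ck k D (fun x => g (h x)).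
Proof.
move=> oD oE hE Ch /(Ck_rVP _ _ oE) Cg; apply/Ck_rVP => // i.
exact: (Ck_comp (g := fun y => g y 0 i)) (Cg i).
Qed.

Lemma Ck_det V n (D : set V) (A : V -> 'M[R]_n) k : open D ->
  (forall i j, Ck k D (fun x => A x i j : R^o)) ->
  Ck k D (fun x => \det (A x) : R^o).
Proof.
move=> oD CA; apply: Ck_sum => // s; apply: Ck_mul => //; first exact: Ck_cst.
by apply: Ck_prod => // i; exact: CA.
Qed.

(** Cramer's rule: the entries of the inverse are cofactors divided by the determinant. *)
Lemma Ck_invmx V n (D : set V) (A : V -> 'M[R]_n) k i j : open D ->
  (forall x, D x -> \det (A x) != 0) ->
  (forall i j, Ck k D (fun x => A x i j : R^o)) ->
  Ck k D (fun x => invmx (A x) i j : R^o).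
Proof.
move=> oD A0 CA.
have CAij : Ck k D (fun x => \det (row' j (col' i (A x))) : R^o).
  apply: Ck_det => // i' j'; apply: Ck_eq (CA (lift j i') (lift i j')) => //.
  by move=> x _; rewrite !mxE.
have := Ck_mul oD (Ck_inv oD A0 (Ck_det oD CA))
  (Ck_mul oD (Ck_cst D ((-1) ^+ (j + i) : R^o) k) CAij).
apply: Ck_eq => // x Dx.
by rewrite /invmx unitmxE unitfE A0 // !mxE.
Qed.

Lemma open_Ck_neq0 V (D : set V) (g : V -> R^o) k : open D -> Ck k D g ->
  open (D `&` [set x | g x != 0]).
Proof.
move=> oD Cg; rewrite openE => x [Dx gx].
have := open_nbhs_nbhs (conj oD Dx); apply: filterS2 (cvgr_neq0 _ (Ck_cont Cg Dx) gx).
by move=> y /= gy Dy.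
Qed.

End CkCalculus.

(** * Curves in level sets *)

Section MeanValue.
Context {R : realType}.
Implicit Types V W : normedModType R.

Lemma rV_norm_le n (A : 'rV[R]_n) (C : R) : 0 <= C ->
  (forall i, `|A 0 i| <= C) -> `|A| <= C.
Proof.
move=> C0 AC; rewrite /Num.Def.normr/= mx_normrE (bigmax_le _ C0)//= => -[i j] _.
by rewrite ord1; exact: AC.
Qed.

Lemma coord_norm_le n (A : 'rV[R]_n) i : `|A 0 i| <= `|A|.
Proof.
rewrite [leRHS]/Num.Def.normr/= mx_normrE.
exact: (le_bigmax _ (fun ij => `|A ij.1 ij.2|) (0, i)).
Qed.

Lemma mulmx_bounded n p (B : 'M[R]_(n, p)) :
  exists2 C : R, 0 < C & forall s : 'rV_n, `|s *m B| <= C * `|s|.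
Proof.
have lB : linear (mulmxr B : 'rV_n -> 'rV_p) by exact: linearP.
have cB : continuous (mulmxr B : 'rV_n -> 'rV_p).
  move=> s; apply: differentiable_continuous.
  by have [] := linear_rV_differentiable s lB.
by have [C C0 CB] := linear_lipschitz cB; exists C.
Qed.

Lemma differentiable_line V (x v : V) (t : R^o) :
  differentiable (fun t : R^o => x + t *: v) t.
Proof. by []. Qed.

(** The difference quotient is constant. This serves functions that are affine in one direction,
    such as the Hamiltonian in lambda. *)
Lemma derive_affine V W (f : V -> W) (v y : V) (w : W) :
  (forall t : R, f (t *: v + y) = f y + t *: w) -> 'D_v f y = w.
Proof.
move=> fE; apply: cvg_lim => //; apply: cvg_near_cst; near=> t.
rewrite /= fE addrAC subrr add0r scalerA mulVf ?scale1r //.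
by near: t; exact: nbhs_dnbhs_neq.
Unshelve. all: by end_near. Qed.

Lemma derive_line V (x v : V) (w t : R^o) :
  'D_w (fun t : R^o => x + t *: v) t = w *: v.
Proof.
apply: derive_affine => a.
by rewrite [a *: w + t]addrC scalerDl addrA [a *: w]/(a * w) scalerA.
Qed.

Lemma smooth_line V (x v : V) (D : set R^o) :
  smooth_on D (fun t : R^o => x + t *: v).
Proof.
case=> [t _|k]; first by apply: differentiable_continuous; exact: differentiable_line.
split=> [t _|a]; first exact: differentiable_line.
have -> : (fun t => 'D_a (fun t : R^o => x + t *: v) t) = cst (a *: v).
  by apply/funext => t; rewrite derive_line.
exact: Ck_cst.
Qed.

(** The scalar mean value theorem is applied to each coordinate along the segment; since the norm is
    the maximum over the coordinates, the bounds combine with the same [C]. *)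
Lemma mean_value V p (g : V -> 'rV[R]_p) (D : set V) (C : R) (x y : V) :
  (forall t : R, 0 <= t <= 1 -> D (x + t *: (y - x))) ->
  (forall z, D z -> differentiable g z) ->
  (forall z, D z -> `|'D_(y - x) g z| <= C) -> `|g y - g x| <= C.
Proof.
move=> seg dg DgC.
have C0 : 0 <= C.
  apply: le_trans (DgC x _) => //.
  by rewrite -[x]addr0 -(scale0r (y - x)); apply: seg; rewrite lexx ler01.
apply: rV_norm_le => // i; rewrite !mxE.
pose h (t : R^o) := x + t *: (y - x).
pose f (t : R) : R := g (h t) 0 i.
have df (t : R) : 0 <= t <= 1 -> differentiable (f : R^o -> R^o) t.
  move=> t01; apply: (differentiable_rVP (g \o h) t).1.
  by apply: differentiable_comp => //; exact/dg/seg.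
have dE (t : R) : 0 <= t <= 1 -> 'D_1 (f : R^o -> R^o) t = 'D_(y - x) g (h t) 0 i.
  move=> t01; rewrite -(@derive_coord _ _ _ (g \o h)); last first.
    by apply: differentiable_comp => //; exact/dg/seg.
  rewrite [in LHS]derive_comp //; last exact/dg/seg.
  by rewrite derive_line scale1r -deriveE //; exact/dg/seg.
have [||c + fE] := @MVT_segment R f (fun t => 'D_1 (f : R^o -> R^o) t) 0 1 ler01.
- move=> t; rewrite in_itv /= => /andP[t0 t1].
  by apply: DeriveDef => //; apply: diff_derivable; apply: df; rewrite !ltW.
- apply: continuous_in_subspaceT => t; rewrite inE /= in_itv /= => t01.
  exact: differentiable_continuous (df t t01).
rewrite in_itv /= => c01; move: fE.
rewrite /f /h scale1r scale0r addr0 [x + (y - x)]addrC subrK => ->.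
rewrite subr0 mulr1 dE //; apply: le_trans (coord_norm_le _ _) _.
exact/DgC/seg.
Qed.

End MeanValue.

(** * Implicit function theorem along a right inverse of the differential *)

Section LevelCurve.
Context {R : realType} (N M : nat).
Variables (O : set 'rV[R]_N) (K : 'rV[R]_N -> 'rV[R]_M).
Variables (y0 v : 'rV[R]_N) (B : 'M[R]_(M, N)).
Hypotheses (oO : open O) (Oy0 : O y0) (smK : smooth_on O K).
Hypotheses (Ky0 : K y0 = 0) (dKB : forall s, 'd K y0 (s *m B) = s).

Let psi (t : R) (s : 'rV[R]_M) : 'rV[R]_N := y0 + t *: v + s *m B.

Let dK y : O y -> differentiable K y.
Proof. exact: Ck_diff (smK 1). Qed.

Let cDK w y : O y -> {for y, continuous ('D_w K : 'rV_N -> 'rV_M)}.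
Proof. by move=> Oy; have [_ /(_ w)] := smK 1; apply. Qed.

(* The matrix of [s |-> 'd K y (s *m B)], the derivative of [K (psi t s)] in
   [s]; it is the identity at [y0]. *)
Let AK y : 'M[R]_M := \matrix_(j, i) ('D_(row j B) K y) 0 i.

Let AKE y s : O y -> s *m AK y = 'd K y (s *m B).
Proof.
move=> Oy; rewrite (mulmx_sum_row s B) linear_sum; apply/rowP => i.
rewrite mxE summxE; apply: eq_bigr => j _.
by rewrite linearZ !mxE deriveE //; exact: dK.
Qed.

Let AK0 : AK y0 = 1%:M.
Proof. by apply/row_matrixP => i; rewrite !rowE mulmx1 AKE // dKB. Qed.

(** The directional derivatives of [K] are continuous at [y0]. The third bound, which comes from
    [AK y0] being the identity, yields both the contraction and the invertibility of [AK]. *)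
Lemma local_bounds : exists2 d : R, 0 < d & exists2 C : R, 0 < C &
  forall t (s : 'rV[R]_M), `|t| <= d -> `|s| <= d ->
    [/\ O (psi t s), `|'D_v K (psi t s)| <= C
      & forall w : 'rV[R]_M, `|w - w *m AK (psi t s)| <= 2^-1 * `|w|].
Proof.
pose C := `|'D_v K y0| + 1.
have C0 : 0 < C by rewrite ltr_pwDr.
(* A matrix with entries bounded by [eta] multiplies the maximum norm of a row vector by at most M *
   eta <= 1/2; [M.+1] keeps [eta] positive when M = 0. *)
pose eta : R := (2 * M.+1%:R)^-1.
have eta0 : 0 < eta by rewrite invr_gt0 mulr_gt0.
have nW : \forall y \near y0, [/\ O y, `|'D_v K y| <= C
    & forall j i, `|AK y j i - AK y0 j i| <= eta].
  near=> y; split.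
  - by near: y; exact: open_nbhs_nbhs.
  - have : `|'D_v K y0 - 'D_v K y| <= 1.
      by near: y; have /cvgrPdist_le := @cDK v y0 Oy0; apply.
    move=> le1; rewrite -[X in `|X|](subrK ('D_v K y0)) (le_trans (ler_normD _ _)) //.
    by rewrite distrC addrC lerD2l.
  - move=> j i; rewrite !mxE distrC.
    have : `|'D_(row j B) K y0 - 'D_(row j B) K y| <= eta.
      move: j {i}; near: y; apply: filter_forall => j.
      by have /cvgrPdist_le := @cDK (row j B) y0 Oy0; apply.
    by apply: le_trans; have := coord_norm_le ('D_(row j B) K y0 - 'D_(row j B) K y) i;
       rewrite !mxE.
have [e /= e0 eW] := (nbhs_ballP _ _).1 nW.
have [CB CB0 leCB] := mulmx_bounded B.
(* For |t| and |s| at most e / (2 L), the displacement t v + s B has norm at most e / 2, hence stays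
   in the ball of radius e. *)
pose L := `|v| + CB + 1.
have L0 : 0 < L by rewrite ltr_pwDr // addr_ge0 // ltW.
exists (e / (2 * L)); first by rewrite divr_gt0 // mulr_gt0.
exists C => // t s tle sle.
have [Oy Dv Dw] : [/\ O (psi t s), `|'D_v K (psi t s)| <= C
    & forall j i, `|AK (psi t s) j i - AK y0 j i| <= eta].
  apply: eW; rewrite -ball_normE /= /psi -addrA opprD addrA subrr add0r normrN.
  apply: le_lt_trans (ler_normD _ _) _; rewrite normrZ.
  apply: (@le_lt_trans _ _ (e / (2 * L) * `|v| + CB * (e / (2 * L)))).
    apply: lerD; first by rewrite ler_wpM2r.
    by apply: le_trans (leCB s) _; rewrite ler_wpM2l // ltW.
  rewrite [CB * _]mulrC -mulrDr.
  apply: (@le_lt_trans _ _ (e / (2 * L) * L)).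
    by rewrite ler_wpM2l ?divr_ge0 ?mulr_ge0 ?(ltW e0) ?(ltW L0) // lerDl.
  rewrite invfM mulrA mulfVK ?gt_eqF // ltr_pdivrMr // ltr_pMr //.
  by rewrite ltr1n.
split=> // w.
rewrite -[w in w - _]mulmx1 -AK0 -mulmxBr.
apply: rV_norm_le; first by rewrite mulr_ge0.
move=> i; rewrite mxE; apply: le_trans (ler_norm_sum _ _ _) _.
apply: (@le_trans _ _ (\sum_(j < M) `|w| * eta)).
  apply: ler_sum => j _; rewrite normrM ler_pM ?coord_norm_le //.
  by rewrite [X in `|X|]mxE [X in _ + X]mxE distrC.
rewrite sumr_const card_ord -mulrnAr mulrC ler_wpM2r // -mulr_natr.
rewrite /eta invfM -mulrA ler_piMr // mulrC ler_pdivrMr // mul1r.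
by rewrite ler_nat.
Unshelve. all: by end_near. Qed.

(** A zero of [K] on the slice [psi t] is a fixed point of s - K (psi t s), which contracts by 1/2.
    The bound on [AK] and the Lipschitz bound are what the differentiation of [s] will require. *)
Lemma level_set_graph : exists2 e : R, 0 < e & exists2 L : R, 0 < L &
  exists s : R -> 'rV[R]_M,
    [/\ s 0 = 0,
        forall t, `|t| < e -> [/\ O (psi t (s t)), K (psi t (s t)) = 0
           & forall w : 'rV[R]_M, `|w - w *m AK (psi t (s t))| <= 2^-1 * `|w|]
      & forall t t', `|t| < e -> `|t'| < e -> `|s t - s t'| <= L * `|t - t'|].
Proof.
have [d d0 [C C0 bnd]] := local_bounds.
(* The derivative of s - K (psi t s) along w is [w - w *m AK (psi t s)], so the third bound and the
   mean value inequality give a contraction. *)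
have Phi t (s s' : 'rV[R]_M) : `|t| <= d -> `|s| <= d -> `|s'| <= d ->
    `|(s - K (psi t s)) - (s' - K (psi t s'))| <= 2^-1 * `|s - s'|.
  move=> td sd sd'.
  have linB : linear (fun z : 'rV[R]_M => z *m B).
    by move=> a b c; rewrite mulmxDl scalemxAl.
  have dpsi z : differentiable (psi t) z.
    have [dB _] := linear_rV_differentiable z linB.
    by apply: (@differentiableD _ _ _ (cst (y0 + t *: v)) (fun z => z *m B)).
  have Dpsi w z : 'D_w (psi t) z = w *m B.
    apply: derive_affine => a.
    by rewrite /psi mulmxDl -scalemxAl [a *: (w *m B) + _]addrC addrA.
  have dKp z : `|z| <= d -> differentiable (fun s => K (psi t s)) z.
    move=> zd; apply: (differentiable_comp (f := psi t) (g := K)) => //.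
    by apply: dK; have [] := bnd t z td zd.
  apply: (mean_value (g := fun s => s - K (psi t s)) (D := [set z | `|z| <= d])).
  - move=> a /andP[a0 a1] /=.
    have -> : s' + a *: (s - s') = (1 - a) *: s' + a *: s.
      by rewrite scalerBl scale1r scalerBr addrA addrAC.
    apply: le_trans (ler_normD _ _) _; rewrite !normrZ !ger0_norm ?subr_ge0 //.
    rewrite -[leRHS]mul1r -[X in _ <= X * d](subrK a 1) [leRHS]mulrDl.
    by apply: lerD; rewrite ler_wpM2l // subr_ge0.
  - move=> z /= zd; apply: (@differentiableB _ _ _ id (fun s => K (psi t s))) => //.
    exact: dKp.
  - move=> z /= zd; have [Oz _ Az] := bnd t z td zd.
    rewrite -[X in 'D_ _ X _]/(id - (fun s => K (psi t s))).
    rewrite deriveB //; last by apply: diff_derivable; exact: dKp.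
    rewrite derive_id derive_comp //; last exact: dK.
    by rewrite Dpsi -AKE.
have Lip (t t' : R) (s : 'rV[R]_M) : `|t| <= d -> `|t'| <= d -> `|s| <= d ->
    `|K (psi t s) - K (psi t' s)| <= C * `|t - t'|.
  move=> td td' sd.
  have psiE : (fun a => psi a s) = fun a : R^o => (y0 + s *m B) + a *: v.
    by apply/funext => a; rewrite /psi addrAC.
  have dp (z : R^o) : differentiable (fun a => psi a s : 'rV_N) z.
    by rewrite psiE.
  apply: (mean_value (g := fun a : R^o => K (psi a s)) (D := [set z | `|z| <= d])).
  - move=> a /andP[a0 a1] /=.
    have -> : t' + a *: (t - t') = (1 - a) * t' + a * t.
      by rewrite /GRing.scale /=; ring.
    have a1' : 0 <= 1 - a by rewrite subr_ge0.
    apply: le_trans (ler_normD _ _) _; rewrite !normrM (ger0_norm a0) (ger0_norm a1').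
    rewrite -[leRHS]mul1r -[X in _ <= X * d](subrK a 1) [leRHS]mulrDl.
    by apply: lerD; rewrite ler_wpM2l // subr_ge0.
  - move=> z /= zd; apply: (differentiable_comp (f := fun a : R^o => psi a s)) => //.
    by apply: dK; have [] := bnd z s zd sd.
  - move=> z /= zd; have [Oz Dz _] := bnd z s zd sd.
    rewrite derive_comp //; last exact: dK.
    rewrite psiE derive_line linearZ normrZ mulrC ler_wpM2r //.
    by rewrite -deriveE //; exact: dK.
(* For |t| <= d / (2 C) the map sends 0 to within d / 2 of 0, and the contraction adds at most d /
   2: the closed ball of radius d is preserved. *)
pose e := Num.min d (d / (2 * C)).
have e0 : 0 < e by rewrite lt_min d0 divr_gt0 // mulr_gt0.
have ed (t : R) : `|t| < e -> `|t| <= d.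
  by move=> te; apply: ltW (lt_le_trans te _); rewrite ge_min lexx.
have fix_ex (t : R) : `|t| < e -> exists s, `|s| <= d /\ K (psi t s) = 0.
  move=> te; have td := ed t te.
  pose F s := s - K (psi t s).
  have F0 : `|F 0| <= 2^-1 * d.
    have -> : F 0 = - (K (psi t 0) - K (psi 0 0)).
      by rewrite /F {3}/psi scale0r mul0mx !addr0 Ky0 subr0 sub0r.
    rewrite normrN; apply: le_trans (Lip _ _ _ td _ _) _;
      rewrite ?normr0 ?(ltW d0) // subr0.
    have : `|t| <= d / (2 * C).
      by apply: ltW (lt_le_trans te _); rewrite ge_min lexx orbT.
    rewrite ler_pdivlMr ?mulr_gt0 // => h.
    by move: h; set a := `|t|; lra.
  have Fd (s : 'rV[R]_M) : `|s| <= d -> `|F s| <= d.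
    move=> sd; rewrite -[F s](subrK (F 0)); apply: le_trans (ler_normD _ _) _.
    have := Phi t s 0 td sd; rewrite normr0 => /(_ (ltW d0)); rewrite subr0 => h.
    have : 2^-1 * `|s| <= 2^-1 * d by rewrite ler_wpM2l.
    move: h F0; rewrite -/(F s) -/(F 0); set a := `|F s - F 0|; lra.
  have cF (s : 'rV[R]_M) : `|s| <= d -> {for s, continuous (fun s => `|F s - s|)}.
    move=> sd; apply: (@continuous_comp _ _ _ (fun s => F s - s) Num.norm);
      last exact: norm_continuous.
    have -> : (fun s => F s - s) = (fun s => - K (psi t s)).
      by apply/funext => x; rewrite /F addrAC subrr add0r.
    apply: continuousN; apply: differentiable_continuous.
    have linB : linear (fun z : 'rV[R]_M => z *m B).
      by move=> a b c; rewrite mulmxDl scalemxAl.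
    have [dB _] := linear_rV_differentiable s linB.
    apply: (differentiable_comp (f := psi t) (g := K)).
      by apply: (@differentiableD _ _ _ (cst (y0 + t *: v)) (fun z => z *m B)).
    by apply: dK; have [] := bnd t s td sd.
  (* In place of an iteration, |F s - s| is minimized over the compact ball. Comparing a minimizer s
     with F s gives |F s - s| <= |F s - s| / 2, so s is fixed. *)
  have [||| s] := @EVT_min_rV R M (fun s => `|F s - s|) [set s | `|s| <= d].
  - by exists 0; rewrite /= normr0 ltW.
  - apply: bounded_closed_compact.
      by exists d; split; [exact: num_real|move=> x /ltW dx s /= /le_trans; apply].
    rewrite -[X in closed X]/(Num.norm @^-1` [set x | x <= d]).
    apply: preimage_closed; last exact: closed_le.
    by move=> x _; exact: norm_continuous.
  - by apply: continuous_in_subspaceT => s; rewrite inE; exact: cF.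
  rewrite inE /= => sd smin; exists s; split=> //.
  have := smin (F s); rewrite inE /= => /(_ (Fd s sd)) h.
  have h2 := Phi t (F s) s td (Fd s sd) sd.
  have : `|F s - s| <= 2^-1 * `|F s - s| by apply: le_trans h _; exact: h2.
  have := normr_ge0 (F s - s) => h3 h4.
  have : `|F s - s| = 0 by lra.
  move=> /eqP; rewrite normr_eq0 /F addrAC subrr add0r oppr_eq0 => /eqP //.
have [s sP] : exists s : R -> 'rV[R]_M, forall t, `|t| < e ->
    `|s t| <= d /\ K (psi t (s t)) = 0.
  have /choice [s sP] : forall t, exists s, `|t| < e ->
      `|s| <= d /\ K (psi t s) = 0.
    move=> t; have [te|te] := pselect (`|t| < e); last by exists 0.
    by have [s ?] := fix_ex t te; exists s.
  by exists s.
exists e => //; exists (2 * C); first by rewrite mulr_gt0.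
exists s; split.
(* The choice of [s 0] was arbitrary; the contraction estimate against the fixed point 0 shows that
   it is 0. *)
- have z0 : `|0 : R| < e by rewrite normr0.
  have [sd Ks] := sP 0 z0.
  have := Phi 0 (s 0) 0 (ed _ z0) sd; rewrite Ks normr0 => /(_ (ltW d0)).
  rewrite {1}/psi scale0r mul0mx !addr0 Ky0 !subr0 => h.
  have h2 := normr_ge0 (s 0).
  by apply/eqP; rewrite -normr_eq0; apply/eqP; lra.
- move=> t te; have [sd Ks] := sP t te.
  by have [] := bnd t (s t) (ed t te) sd.
- move=> t t' te te'; have [sd Ks] := sP t te; have [sd' Ks'] := sP t' te'.
  have h1 := Phi t (s t) (s t') (ed _ te) sd sd'.
  have h2 := Lip t t' (s t') (ed _ te) (ed _ te') sd'.
  move: h1 h2; rewrite Ks Ks' !subr0 => h1 h2.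
  (* The right-hand side is at most |s t - s t'| / 2 + C |t - t'|; absorbing the half gives the
     constant 2 C. *)
  have : `|s t - s t'| <= `|s t - (s t' - K (psi t (s t')))| + `|K (psi t (s t'))|.
    rewrite -[X in X <= _]normrN.
    rewrite (_ : - (s t - s t') =
      - (s t - (s t' - K (psi t (s t')))) + K (psi t (s t'))).
      by apply: le_trans (ler_normD _ _) _; rewrite normrN.
    by rewrite !opprB addrAC subrK.
  move=> h3; move: h1 h2 h3 C0; set a := `|s t - s t'|; set b := `|t - t'|.
  by move=> *; nra.
Qed.

Let DvK y := 'D_v K y : 'rV[R]_M.

(* The curve solves the ordinary differential equation [c' = Xi c]. *)
Let Xi y : 'rV[R]_N := v - (DvK y *m invmx (AK y)) *m B.

Let E := O `&` [set y | \det (AK y) != 0].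

Let CAK k i j : Ck k O (fun y => AK y i j : R^o).
Proof.
have [_ /(_ (row i B)) C] := smK k.+1.
by apply: Ck_eq ((Ck_rVP _ _ oO).1 C j) => // y _; rewrite mxE.
Qed.

Let oE : open E.
Proof.
by apply: (open_Ck_neq0 (k := 0)) => //; apply: Ck_det => // i j; exact: CAK.
Qed.

Let CXi k : Ck k E Xi.
Proof.
have OE : E `<=` O by move=> y [].
apply/Ck_rVP => // i.
have CDv j : Ck k E (fun y => DvK y 0 j : R^o).
  have [_ /(_ v) C] := smK k.+1.
  exact: Ck_subset OE ((Ck_rVP _ _ oO).1 C j).
have Cinv j l : Ck k E (fun y => invmx (AK y) j l : R^o).
  apply: Ck_invmx => // [y []//|i' j'].
  exact: Ck_subset OE (CAK _ _ _).
pose g y : R^o := v 0 i +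
  \sum_(l < M) (\sum_(j < M) DvK y 0 j * invmx (AK y) j l) * - B l i.
apply: (@Ck_eq _ _ _ _ g) => //.
  by move=> y _; rewrite /Xi !mxE /g -sumrN; congr (_ + _);
     apply: eq_bigr => l _; rewrite !mxE mulrN.
apply: Ck_add => //; first exact: Ck_cst.
apply: Ck_sum => // l; apply: Ck_mul => //; last exact: Ck_cst.
by apply: Ck_sum => // j; exact: Ck_mul.
Qed.

(** The curve is c t = psi t (s t). Differentiating K (c t) = 0 gives s' and hence c' = Xi c, so
    that C^k regularity of c yields C^(k+1). At t = 0 the correction term of [Xi] vanishes because
    dK v = 0. *)
Lemma level_curve_right_inverse : 'd K y0 v = 0 ->
  exists (c : R^o -> 'rV[R]_N) (e : R),
    [/\ 0 < e, c 0 = y0, forall t, `|t| < e -> O (c t) /\ K (c t) = 0,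
        smooth_on [set t : R^o | `|t| < e] c & 'D_1 c 0 = v].
Proof.
move=> dKv; have [e e0 [L L0 [s [s0 sP sL]]]] := level_set_graph.
pose c (t : R^o) := psi t (s t); pose D := [set t : R^o | `|t| < e].
have oD : open D.
  have -> : D = ball (0 : R^o) e; last exact: ball_open.
  by apply/seteqP; split=> t; rewrite -ball_normE /= sub0r normrN.
have c0 : c 0 = y0 by rewrite /c s0 /psi scale0r mul0mx !addr0.
have Ec t : D t -> E (c t).
  move=> /sP[Oc _ Ac]; split=> //=.
  (* A row vector w killed by [AK (c t)] satisfies |w| <= |w| / 2, hence is 0. *)
  rewrite -unitfE -unitmxE -row_free_unit; apply: inj_row_free => w wA.
  have := Ac w; rewrite wA subr0 => h; have := normr_ge0 w => h1.
  by apply/eqP; rewrite -normr_eq0; apply/eqP; lra.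
have [CB CB0 leCB] := mulmx_bounded B.
have ds t : D t ->
    is_derive (t : R^o) 1 (s : R^o -> 'rV[R]_M) (- (DvK (c t) *m invmx (AK (c t)))).
  move=> Dt; have [Oc Ac] := Ec t Dt; have [_ Kc _] := sP t Dt.
  set sg := - _.
  have uA : AK (c t) \in unitmx by rewrite unitmxE unitfE.
  have [CA CA0 leCA] := mulmx_bounded (invmx (AK (c t))).
  suff lim_s : h^-1 *: ((s \o shift t) (h *: (1 : R^o)) - s t) @[h --> 0^'] --> sg.
    by apply: DeriveDef; [apply/cvg_ex; exists sg|exact/cvg_lim].
  apply/cvgrPdist_le => eps eps0.
  (* [L'] bounds the increments of c by L' |h|, and [eta] is the accuracy in the expansion of [K]
     for which CA * eta * L' = eps. *)
  pose L' := `|v| + CB * L + 1.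
  have L'0 : 0 < L' by rewrite ltr_pwDr // addr_ge0 ?mulr_ge0 // ltW.
  pose eta := eps / (CA * L').
  have eta0 : 0 < eta by rewrite divr_gt0 // mulr_gt0.
  have /diff_locally /eqaddoP dKc := dK Oc.
  have [d /= d0 dd] := (nbhs_ballP _ _).1 (dKc _ eta0).
  have e10 : 0 < e - `|t| by rewrite subr_gt0.
  near=> h.
  have h0 : h != 0 by near: h; exact: nbhs_dnbhs_neq.
  have Dht : `|h + t| < e.
    apply: le_lt_trans (ler_normD _ _) _; rewrite -ltrBrDr.
    by near: h; exact: dnbhs0_lt.
  have hd : `|h| < d / L' by near: h; apply: dnbhs0_lt; rewrite divr_gt0.
  pose del := c (h + t) - c t.
  have delE : del = h *: v + (s (h + t) - s t) *m B.
    rewrite /del /c /psi mulmxBl; move: (s _ *m B) (s t *m B) => X Y.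
    by apply/rowP => i; rewrite !mxE; ring.
  have dels : `|del| <= L' * `|h|.
    rewrite delE; apply: le_trans (ler_normD _ _) _; rewrite normrZ.
    have h1 := leCB (s (h + t) - s t).
    have h2 := sL (h + t) t Dht Dt; rewrite addrK in h2.
    have h3 : CB * `|s (h + t) - s t| <= CB * (L * `|h|) by rewrite ler_wpM2l // ltW.
    rewrite /L' !mulrDl mul1r -mulrA [`|v| * _]mulrC.
    have := normr_ge0 h; lra.
  have deld : ball 0 d del.
    rewrite -ball_normE /= sub0r normrN; apply: le_lt_trans dels _.
    by rewrite mulrC -ltr_pdivlMr.
  have Kdel := dd _ deld.
  have [_ Kct _] := sP (h + t) Dht.
  have dKdel : 'd K (c t) del = h *: DvK (c t) + (s (h + t) - s t) *m AK (c t).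
    by rewrite (AKE _ Oc) delE linearD linearZ /DvK (deriveE _ (dK Oc)).
  (* [K] vanishes at both c t and c (h + t), so the remainder of its expansion is, up to sign, the
     linear term. *)
  have hb : `|h *: DvK (c t) + (s (h + t) - s t) *m AK (c t)| <= eta * `|del|.
    rewrite -dKdel -normrN; apply: le_trans Kdel.
    by rewrite !fctE /= /del subrK -/(c t) [K (c t)]Kc [K _]Kct !add0r.
  have -> : sg - h^-1 *: ((s \o shift t) (h *: (1 : R^o)) - s t) =
     h^-1 *: - ((h *: DvK (c t) + (s (h + t) - s t) *m AK (c t))
                 *m invmx (AK (c t))).
    rewrite mulmxDl mulmxK // -scalemxAl opprD [RHS]scalerDr !scalerN scalerA mulVf //.
    by rewrite scale1r /= [h%:A]mulr1.
  rewrite normrZ normrN normfV ler_pdivrMl ?normr_gt0 //.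
  apply: le_trans (leCA _) _.
  apply: (@le_trans _ _ (CA * (eta * (L' * `|h|)))).
    rewrite ler_wpM2l ?(ltW CA0) //; apply: le_trans hb _.
    by rewrite ler_wpM2l // ltW.
  have <- : eta * (CA * L') = eps.
    by rewrite /eta divfK // gt_eqF // mulr_gt0.
  by have -> : CA * (eta * (L' * `|h|)) = `|h| * (eta * (CA * L')) by ring.
have dc (t : R^o) : D t -> differentiable c t /\ forall w, 'D_w c t = w *: Xi (c t).
  move=> Dt; have dst := ds t Dt.
  have dfs : differentiable (s : R^o -> 'rV[R]_M) t.
    by apply/derivable1_diffP; have [] := dst.
  have linB : linear (fun z : 'rV[R]_M => z *m B).
    by move=> a b z; rewrite mulmxDl scalemxAl.
  have [dB dBE] := linear_rV_differentiable (s t) linB.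
  have dsB : differentiable (fun t : R^o => s t *m B) t.
    exact: (differentiable_comp (f := s : R^o -> _) (g := fun z => z *m B)).
  have dct : differentiable c t.
    exact: (@differentiableD _ _ _ (fun t : R^o => y0 + t *: v)).
  have dl : differentiable (fun t : R^o => y0 + t *: v) t.
    exact: differentiable_line.
  have Dc : 'D_1 c t = Xi (c t).
    rewrite -[LHS]/('D_1 ((fun t : R^o => y0 + t *: v) +
                         (fun t : R^o => s t *m B)) t).
    rewrite (deriveD (diff_derivable dl) (diff_derivable dsB)) derive_line.
    rewrite (derive_comp (h := s : R^o -> _) (g := fun z => z *m B) _ dfs dB) dBE.
    by rewrite derive_val scale1r /Xi mulNmx.
  split=> // w; rewrite -Dc !(deriveE _ dct) -linearZ.
  by rewrite /GRing.scale /= mulr1.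
have Cc k : Ck k D c.
  elim: k => [t Dt|k IH] /=.
    by apply: differentiable_continuous; have [] := dc t Dt.
  split=> [t Dt|w]; first by have [] := dc t Dt.
  have C := Ck_comp_rV oD oE Ec IH (CXi k).
  apply: (@Ck_eq _ _ _ _ (fun t => w *: Xi (c t))) => //.
    by move=> t Dt; have [_ ->] := dc t Dt.
  apply/Ck_rVP => // i.
  apply: Ck_eq (Ck_mul oD (Ck_cst _ (w : R^o) _) ((Ck_rVP _ _ oD).1 C i)) => //.
  by move=> t _; rewrite [RHS]mxE.
exists c, e; split=> //.
- by move=> t /sP[].
- have D0 : D 0 by rewrite /D /= normr0.
  have [_ ->] := dc 0 D0; rewrite scale1r /Xi c0 /DvK deriveE ?dKv //.
    by rewrite !mul0mx subr0.
  exact: dK.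
Unshelve. all: by end_near. Qed.

End LevelCurve.

(** The rows of a right inverse are preimages of the standard basis under the differential. *)
Lemma level_curve (R : realType) (N M : nat) (O : set 'rV[R]_N)
    (K : 'rV[R]_N -> 'rV[R]_M) (y0 v : 'rV[R]_N) :
  open O -> O y0 -> smooth_on O K -> K y0 = 0 ->
  (forall w, exists u, 'd K y0 u = w) -> 'd K y0 v = 0 ->
  exists (c : R^o -> 'rV[R]_N) (e : R),
    [/\ 0 < e, c 0 = y0, forall t, `|t| < e -> O (c t) /\ K (c t) = 0,
        smooth_on [set t : R^o | `|t| < e] c & 'D_1 c 0 = v].
Proof.
move=> oO Oy0 smK Ky0 surj.
have /choice [b bP] : forall i : 'I_M, exists u, 'd K y0 u = delta_mx 0 i.
  by move=> i; exact: surj.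
apply: (@level_curve_right_inverse R N M O K y0 v (\matrix_i b i)) => // s.
rewrite mulmx_sum_row linear_sum [RHS]row_sum_delta; apply: eq_bigr => i _.
by rewrite linearZ rowK bP.
Qed.

(** * The constraint in coordinates *)

Section LocalModel.
Context {R : realType}.
Implicit Types V W : normedModType R.

(** Only the values on the two lines enter, so derivatives can be compared between spaces of
    different dimension, such as the total space and the base. *)
Lemma derive_slice V V' W (f : V -> W) (g : V' -> W) v v' y x :
  (forall t : R, f (t *: v + y) = g (t *: v' + x)) -> 'D_v f y = 'D_v' g x.
Proof.
move=> fg; rewrite /derive.
have -> : (fun t : R => t^-1 *: ((f \o shift y) (t *: v) - f y)) =
          (fun t : R => t^-1 *: ((g \o shift x) (t *: v') - g x)); last by [].
apply/funext => t /=; rewrite fg; congr (_ *: (_ - _)).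
by have := fg 0; rewrite !scale0r !add0r.
Qed.

Lemma differentiable_row n m W (g : 'rV[R]_(n + m) -> W) q v :
  differentiable g (row_mx q v) -> differentiable (fun v => g (row_mx q v)) v.
Proof.
move=> dg.
have lina : linear (fun v : 'rV[R]_m => row_mx (0 : 'rV[R]_n) v).
  by move=> t v1 v2; rewrite scale_row_mx add_row_mx scaler0 addr0.
have [da _] := linear_rV_differentiable v lina.
have -> : (fun v => g (row_mx q v)) = g \o (cst (row_mx q 0) + (fun v => row_mx 0 v)).
  by apply/funext => v'; rewrite /= fctE add_row_mx addr0 add0r.
apply: differentiable_comp.
  by apply: (@differentiableD _ _ _ (cst (row_mx q 0)) (fun v => row_mx 0 v)).
by rewrite fctE add_row_mx addr0 add0r.
Qed.

Variables (n m r : nat) (U : set 'rV[R]_(n + m)).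
Variables (F : 'rV[R]_(n + m) -> 'rV[R]_n) (G : 'rV[R]_(n + m) -> 'rV[R]_r).
Hypotheses (oU : open U) (smF : smooth_on U F) (smG : smooth_on U G).

Local Notation T := 'rV[R]_(n + m + (n + r)).

(* [y] stands for [row_mx (row_mx q u) (row_mx p lambda)]. *)
Definition vert (a : 'rV[R]_m) (b : 'rV[R]_r) : T :=
  row_mx (row_mx 0 a) (row_mx 0 b).

Definition local_ham (y : T) : R^o :=
  \sum_(k < n) lsubmx (rsubmx y) 0 k * F (lsubmx y) 0 k +
  \sum_(A < r) rsubmx (rsubmx y) 0 A * G (lsubmx y) 0 A.

Lemma local_ham_row x p l :
  local_ham (row_mx x (row_mx p l)) =
  \sum_(k < n) p 0 k * F x 0 k + \sum_(A < r) l 0 A * G x 0 A.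
Proof. by rewrite /local_ham !row_mxKr !row_mxKl. Qed.

(** These are the partial derivatives of [local_ham] in the vertical directions: those in lambda are
    the components of [G]. *)
Definition local_constraint (y : T) : 'rV[R]_(r + m) :=
  row_mx (G (lsubmx y)) (\row_i 'D_(vert (delta_mx 0 i) 0) local_ham y).

(** When [G] is the local expression of phi, this is convertible to [constraint_jacobian]. *)
Definition local_jacobian (x : 'rV[R]_(n + m)) : 'M[R]_(r, m) :=
  \matrix_(A < r, a < m)
    'D_(row_mx 0 (delta_mx 0 a)) (fun y => G y 0 A : R^o) x.

Local Notation O := (lsubmx @^-1` U : set T).

Lemma open_local : open O.
Proof. by apply: open_comp => // y _; exact: continuous_lsubmx. Qed.

Let Cl k : Ck k O (lsubmx : T -> 'rV[R]_(n + m)).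
Proof. by apply: Ck_linear => a x y; rewrite linearP. Qed.

Let Ch k : Ck k O local_ham.
Proof.
have oO := open_local.
have CF i : Ck k O (fun y : T => F (lsubmx y) 0 i : R^o).
  exact: (Ck_comp (g := fun x => F x 0 i : R^o) oO _ (Cl k)
    ((Ck_rVP _ _ oU).1 (smF k) i)).
have CG i : Ck k O (fun y : T => G (lsubmx y) 0 i : R^o).
  exact: (Ck_comp (g := fun x => G x 0 i : R^o) oO _ (Cl k)
    ((Ck_rVP _ _ oU).1 (smG k) i)).
apply: Ck_add => //; apply: Ck_sum => // i; apply: Ck_mul => //;
  by apply: Ck_linear => a x y; rewrite !linearP !mxE.
Qed.

Lemma smooth_local_constraint : smooth_on O local_constraint.
Proof.
move=> k; have oO := open_local; apply/Ck_rVP => // i.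
case: (split_ordP i) => j ->.
  apply: (@Ck_eq _ _ _ _ (fun y : T => G (lsubmx y) 0 j : R^o)) => //.
    by move=> y _; rewrite row_mxEl.
  exact: (Ck_comp (g := fun x => G x 0 j : R^o) oO _ (Cl k)
    ((Ck_rVP _ _ oU).1 (smG k) j)).
have [_ /(_ (vert (delta_mx 0 j) 0)) C] := Ch k.+1.
by apply: Ck_eq C => // y _; rewrite row_mxEr mxE.
Qed.

Let vertD a b : vert a b = vert a 0 + vert 0 b.
Proof. by rewrite /vert !add_row_mx !addr0 !add0r. Qed.

Let vertZ t a b : t *: vert a b = vert (t *: a) (t *: b).
Proof. by rewrite /vert !scale_row_mx !scaler0. Qed.

Let lsub_vert a b y : lsubmx (vert a b + y) = row_mx 0 a + lsubmx y.
Proof. by rewrite linearD /= /vert row_mxKl. Qed.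

Let plsub_vert a b y : lsubmx (rsubmx (vert a b + y)) = lsubmx (rsubmx y).
Proof. by rewrite !linearD /= /vert row_mxKr row_mxKl add0r. Qed.

Let prsub_vert a b y :
  rsubmx (rsubmx (vert a b + y)) = b + rsubmx (rsubmx y).
Proof. by rewrite !linearD /= /vert !row_mxKr. Qed.

Lemma differentiable_local_ham y : O y -> differentiable local_ham y.
Proof. exact: Ck_diff (Ch 1). Qed.

(** The u-part is expanded over basis vectors, whose derivatives are entries of [local_constraint]
    by definition; the lambda-part is exact because [local_ham] is affine in lambda. *)
Lemma diff_local_ham y a b : O y ->
  'd local_ham y (vert a b) =
    \sum_(i < m) a 0 i * local_constraint y 0 (rshift r i) +
    \sum_(A < r) b 0 A * G (lsubmx y) 0 A.
Proof.
move=> Oy; rewrite vertD linearD; congr (_ + _).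
  rewrite (_ : vert a 0 = \sum_(i < m) a 0 i *: vert (delta_mx 0 i) 0).
    rewrite linear_sum; apply: eq_bigr => i _.
    by rewrite linearZ -deriveE ?row_mxEr ?mxE //; exact: differentiable_local_ham.
  rewrite {1}(row_sum_delta a); apply/rowP => j; rewrite summxE.
  case: (split_ordP j) => l ->; rewrite ?row_mxEl ?row_mxEr.
    case: (split_ordP l) => q ->; rewrite ?row_mxEl ?row_mxEr.
      rewrite mxE big1 // => i _.
      by rewrite mxE row_mxEl row_mxEl mxE mulr0.
    rewrite summxE; apply: eq_bigr => i _.
    by rewrite [LHS]mxE [RHS]mxE row_mxEl row_mxEr.
  rewrite big1 => [|i _]; first by rewrite row_mx0 mxE.
  by rewrite mxE row_mxEr row_mx0 mxE mulr0.
rewrite -deriveE; last exact: differentiable_local_ham.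
apply: derive_affine => t.
rewrite vertZ scaler0 /local_ham lsub_vert plsub_vert prsub_vert row_mx0 add0r.
rewrite -addrA; congr (_ + _); rewrite scaler_sumr -big_split /=.
by apply: eq_bigr => A _; rewrite !mxE mulrDl addrC -mulrA.
Qed.

(** Basis vectors [a] and [b] in [diff_local_ham] isolate the entries of [local_constraint] one by
    one. *)
Lemma local_constraint_eq0 y : O y ->
  local_constraint y = 0 <-> forall a b, 'd local_ham y (vert a b) = 0.
Proof.
move=> Oy; split=> [K0 a b|dh0].
  rewrite diff_local_ham // !big1 ?addr0 // => i _.
    have := congr1 (fun A : 'rV_(r + m) => A 0 (lshift m i)) K0.
    by rewrite row_mxEl mxE => ->; rewrite mulr0.
  by rewrite K0 mxE mulr0.
apply/rowP => i; rewrite [RHS]mxE; case: (split_ordP i) => j ->.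
  have := dh0 0 (delta_mx 0 j); rewrite diff_local_ham // big1 => [|l _].
    rewrite add0r (bigD1 j) //= big1 => [|l lj].
      by rewrite mxE !eqxx mul1r addr0 row_mxEl.
    by rewrite mxE eqxx (negPf lj) mul0r.
  by rewrite mxE mul0r.
have := dh0 (delta_mx 0 j) 0; rewrite diff_local_ham // addrC big1 => [|l _].
  rewrite add0r (bigD1 j) //= big1 => [|l lj].
    by rewrite mxE !eqxx mul1r addr0.
  by rewrite mxE eqxx (negPf lj) mul0r.
by rewrite mxE mul0r.
Qed.

Let dG x A : U x -> differentiable (fun x => G x 0 A : R^o) x.
Proof. by move=> Ux; apply: Ck_diff ((Ck_rVP _ _ oU).1 (smG 1) A) Ux. Qed.

Let dF x A : U x -> differentiable (fun x => F x 0 A : R^o) x.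
Proof. by move=> Ux; apply: Ck_diff ((Ck_rVP _ _ oU).1 (smF 1) A) Ux. Qed.

(** This exhibits the u-derivative of the Hamiltonian as affine in lambda with linear part
    [local_jacobian], the second diagonal block of the derivative of K. *)
Lemma local_constraintE y i : O y ->
  local_constraint y 0 (rshift r i) =
    \sum_(k < n) lsubmx (rsubmx y) 0 k *
      'D_(row_mx 0 (delta_mx 0 i)) (fun x => F x 0 k : R^o) (lsubmx y) +
    (rsubmx (rsubmx y) *m local_jacobian (lsubmx y)) 0 i.
Proof.
move=> Oy; rewrite row_mxEr mxE.
pose P k : 'rV[R]_(n + m) -> R^o := lsubmx (rsubmx y) 0 k \*: (fun x => F x 0 k : R^o).
pose Q A : 'rV[R]_(n + m) -> R^o := rsubmx (rsubmx y) 0 A \*: (fun x => G x 0 A : R^o).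
rewrite (derive_slice (g := \sum_k P k + \sum_A Q A)
  (v' := row_mx 0 (delta_mx 0 i)) (x := lsubmx y)).
  have dP k : derivable (P k) (lsubmx y) (row_mx 0 (delta_mx 0 i)).
    by apply: derivableZ; apply: diff_derivable; exact: dF.
  have dQ k : derivable (Q k) (lsubmx y) (row_mx 0 (delta_mx 0 i)).
    by apply: derivableZ; apply: diff_derivable; exact: dG.
  rewrite deriveD; [|exact: derivable_sum|exact: derivable_sum].
  rewrite !derive_sum //; congr (_ + _).
    apply: eq_bigr => k _; rewrite deriveZ //.
    by apply: diff_derivable; exact: dF.
  rewrite mxE; apply: eq_bigr => k _; rewrite deriveZ ?mxE //.
  by apply: diff_derivable; exact: dG.
move=> t; rewrite vertZ /local_ham lsub_vert plsub_vert prsub_vert scaler0 add0r.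
by rewrite !fctE !fct_sumE scale_row_mx scaler0.
Qed.

(** A block-triangular system is solved: variations of lambda leave phi fixed, so [a] is found from
    the phi-block with the right inverse, and then [b] adjusts the other block with the left
    inverse. *)
Lemma diff_local_constraint_surj y (Br Bl : 'M[R]_(m, r)) : O y ->
  local_jacobian (lsubmx y) *m Br = 1%:M ->
  Bl *m local_jacobian (lsubmx y) = 1%:M ->
  forall w, exists a b, 'd local_constraint y (vert a b) = w.
Proof.
move=> Oy JBr BlJ w.
have dK : differentiable local_constraint y.
  exact: Ck_diff (smooth_local_constraint 1) Oy.
pose a : 'rV[R]_m := (Br *m (lsubmx w)^T)^T.
pose b : 'rV[R]_r := (rsubmx w - rsubmx ('d local_constraint y (vert a 0))) *m Bl.
exists a, b; rewrite vertD linearD.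
have -> : 'd local_constraint y (vert 0 b) = row_mx 0 (b *m local_jacobian (lsubmx y)).
  rewrite -deriveE //; apply: derive_affine => t.
  have Oty : O (t *: vert 0 b + y).
    by rewrite /preimage /= vertZ scaler0 lsub_vert row_mx0 add0r.
  apply/rowP => i; case: (split_ordP i) => j ->.
    rewrite [RHS]mxE [X in _ = _ + X]mxE !row_mxEl [X in _ * X]mxE mulr0 addr0.
    by rewrite vertZ scaler0 lsub_vert row_mx0 add0r.
  rewrite [RHS]mxE [X in _ = _ + X]mxE !local_constraintE // row_mxEr.
  rewrite vertZ scaler0 lsub_vert plsub_vert prsub_vert row_mx0 add0r -addrA.
  by congr (_ + _); rewrite mulmxDl -scalemxAl [LHS]mxE [X in X + _]mxE addrC.
rewrite /b -mulmxA BlJ mulmx1; set X := 'd _ _ _.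
suff lX : lsubmx X = lsubmx w.
  rewrite -{1}[X]hsubmxK add_row_mx addr0 lX.
  by rewrite [rsubmx X + (_ - _)]addrC subrK hsubmxK.
rewrite /X.
apply/rowP => A; rewrite mxE -deriveE // derive_coord //.
rewrite (derive_slice (g := fun x => G x 0 A : R^o) (v' := row_mx 0 a) (x := lsubmx y)).
  rewrite deriveE; last exact: dG.
  rewrite (_ : row_mx 0 a = \sum_i a 0 i *: row_mx (0 : 'rV_n) (delta_mx 0 i)).
    rewrite linear_sum -[in RHS](trmxK (lsubmx w)) -[(lsubmx w)^T]mul1mx -JBr.
    rewrite -mulmxA [RHS]mxE mxE; apply: eq_bigr => i _.
    rewrite linearZ -deriveE; last exact: dG.
    by rewrite !mxE mulrC.
  rewrite {1}(row_sum_delta a); apply/rowP => j; rewrite summxE.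
  case: (split_ordP j) => l ->; rewrite ?row_mxEl ?row_mxEr.
    by rewrite mxE big1 // => i _; rewrite [LHS]mxE row_mxEl [X in _ * X]mxE mulr0.
  by rewrite summxE; apply: eq_bigr => i _; rewrite [LHS]mxE [RHS]mxE row_mxEr.
by move=> t; rewrite row_mxEl vertZ lsub_vert scale_row_mx scaler0.
Qed.

(** By surjectivity on vertical vectors, any velocity (q, p) is completed by a vertical vector to an
    element of the kernel of the differential; [level_curve] then realizes it. *)
Lemma local_curve y (Br Bl : 'M[R]_(m, r)) (q p : 'rV[R]_n) : O y ->
  local_jacobian (lsubmx y) *m Br = 1%:M ->
  Bl *m local_jacobian (lsubmx y) = 1%:M ->
  local_constraint y = 0 ->
  exists (v : T) (c : R^o -> T) (e : R),
    [/\ 0 < e, c 0 = y, forall t, `|t| < e -> O (c t) /\ local_constraint (c t) = 0,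
        smooth_on [set t : R^o | `|t| < e] c & 'D_1 c 0 = v] /\
    lsubmx (lsubmx v) = q /\ lsubmx (rsubmx v) = p.
Proof.
move=> Oy JBr BlJ Ky; have surj := diff_local_constraint_surj Oy JBr BlJ.
pose v0 : T := row_mx (row_mx q 0) (row_mx p 0).
have [a [b abE]] := surj (- 'd local_constraint y v0).
pose v := vert a b + v0.
have [||||||c [e ce]] := @level_curve R _ _ O local_constraint y v.
- exact: open_local.
- by [].
- exact: smooth_local_constraint.
- by [].
- by move=> w; have [a' [b' <-]] := surj w; exists (vert a' b').
- by rewrite linearD abE addNr.
exists v, c, e; split=> //.
rewrite lsub_vert plsub_vert /v0 row_mxKl row_mxKr row_mxKl; split=> //.
by rewrite linearD /= !row_mxKl add0r.
Qed.

(** Near [x] the products J B and B J keep nonzero determinants, so that B (J B)^-1 and (B J)^-1 B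
    are one-sided inverses of J. Using both products avoids identifying the dimensions r and m. *)
Lemma local_jacobian_near x (B : 'M[R]_(m, r)) : U x ->
  local_jacobian x *m B = 1%:M -> B *m local_jacobian x = 1%:M ->
  exists U' : set 'rV[R]_(n + m), [/\ open U', U' x, U' `<=` U &
    forall x', U' x' -> exists Br Bl : 'M[R]_(m, r),
      local_jacobian x' *m Br = 1%:M /\ Bl *m local_jacobian x' = 1%:M].
Proof.
move=> Ux JB BJ.
have CJ A a : Ck 0 U (fun x => local_jacobian x A a : R^o).
  have C : Ck 0 U ('D_(row_mx 0 (delta_mx 0 a)) (fun x => G x 0 A : R^o)).
    by have [_] := (Ck_rVP _ _ oU).1 (smG 1) A; apply.
  by apply: Ck_eq C => // y _; rewrite [RHS]mxE.
have C1 : Ck 0 U (fun x => \det (local_jacobian x *m B) : R^o).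
  apply: Ck_det => // i j.
  apply: (@Ck_eq _ _ _ _ (fun x => \sum_l local_jacobian x i l * B l j : R^o)) => //.
    by move=> y _; rewrite [RHS]mxE.
  by apply: Ck_sum => // l; apply: Ck_mul => //; exact: Ck_cst.
have C2 : Ck 0 U (fun x => \det (B *m local_jacobian x) : R^o).
  apply: Ck_det => // i j.
  apply: (@Ck_eq _ _ _ _ (fun x => \sum_l B i l * local_jacobian x l j : R^o)) => //.
    by move=> y _; rewrite [RHS]mxE.
  by apply: Ck_sum => // l; apply: Ck_mul => //; exact: Ck_cst.
exists ((U `&` [set x | \det (local_jacobian x *m B) != 0]) `&`
        (U `&` [set x | \det (B *m local_jacobian x) != 0])); split.
- by apply: openI; [exact: open_Ck_neq0 C1|exact: open_Ck_neq0 C2].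
- by split; split=> //=; rewrite ?JB ?BJ !det1 oner_neq0.
- by move=> y [[]].
move=> y [[Uy /= d1] [_ /= d2]].
exists (B *m invmx (local_jacobian y *m B)), (invmx (B *m local_jacobian y) *m B).
by rewrite mulmxA -[in X in _ /\ X]mulmxA mulmxV ?mulVmx // unitmxE unitfE.
Qed.

End LocalModel.

(** * Bundles and charts *)

Section LinearAlgebra.
Context {R : realType}.

(** [linfun] accepts any function but agrees with it only under linearity; the trivializations of
    dual bundles and Whitney sums apply it to bare functions. *)
Lemma linfun_linearE (aT rT : vectType R) (f : aT -> rT) :
  linear f -> linfun f =1 f.
Proof.
move=> linf; pose fM := GRing.isLinear.Build _ _ _ _ f linf.
pose g : {linear aT -> rT} := HB.pack f fM.
exact: (lfunE g).
Qed.

Lemma bij_lfunK (aT rT : vectType R) (f : 'Hom(aT, rT)) : bijective f ->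
  cancel f (f^-1)%VF /\ cancel (f^-1)%VF f.
Proof.
move=> [g fK gK].
have fVK : cancel f (f^-1)%VF by apply: lker0_lfunK; apply/lker0P; exact: can_inj fK.
by split=> // v; rewrite -[v in LHS]gK fVK gK.
Qed.

Variables (n : nat) (B : charted_space R n).

Lemma dual_trivE r (E : bundle B r) (j : triv_ix E) x
    (l : fiber (dual_bundle E) x) :
  triv (dual_bundle E) j x l =
  \row_(A < r) ((l : 'Hom(_, R^o)) (((triv E j x)^-1)%VF (delta_mx 0 A)) : R).
Proof.
rewrite /= linfun_linearE // => a l1 l2; apply/rowP => A.
by rewrite !mxE add_lfunE scale_lfunE.
Qed.

(** The dual trivialization takes components in the dual frame, so the pairing is the dot product of
    components in any trivialization. *)
Lemma dual_pairing r (E : bundle B r) (j : triv_ix E) x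
    (l : 'Hom(fiber E x, R^o)) (s : fiber E x) :
  bijective (triv E j x) ->
  l s = \sum_(A < r) triv (dual_bundle E) j x l 0 A * triv E j x s 0 A.
Proof.
move=> /bij_lfunK[tK Kt]; rewrite -{1}(tK s).
rewrite {1}(row_sum_delta (triv E j x s)) !linear_sum; apply: eq_bigr => A _.
by rewrite !linearZ dual_trivE mxE mulrC.
Qed.

Lemma dual_triv_bij r (E : bundle B r) (j : triv_ix E) x :
  bijective (triv E j x) -> bijective (triv (dual_bundle E) j x).
Proof.
move=> bij; have [tK Kt] := bij_lfunK bij.
pose g (v : 'rV[R]_r) (s : fiber E x) : R^o :=
  \sum_(A < r) v 0 A * triv E j x s 0 A.
have ling v : linear (g v).
  move=> a s1 s2; rewrite /g scaler_sumr -big_split; apply: eq_bigr => A _ /=.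
  by rewrite linearP !mxE mulrDr mulrCA.
exists (fun v => linfun (g v)) => [l|v].
  by apply/lfunP => s; rewrite linfun_linearE // /g (dual_pairing _ _ bij).
apply/rowP => A; rewrite dual_trivE mxE linfun_linearE // /g Kt (bigD1 A) //=.
rewrite mxE !eqxx mulr1 big1 ?addr0 // => C CA.
by rewrite mxE (negPf CA) andbF mulr0.
Qed.

Lemma whitney_trivE r s (E : bundle B r) (F : bundle B s) j x
    (e : fiber (whitney_sum E F) x) :
  triv (whitney_sum E F) j x e = row_mx (triv E j.1 x e.1) (triv F j.2 x e.2).
Proof.
rewrite /= linfun_linearE // => a e1 e2.
by rewrite scale_row_mx add_row_mx !linearP.
Qed.

Lemma whitney_triv_bij r s (E : bundle B r) (F : bundle B s) j x :
  bijective (triv E j.1 x) -> bijective (triv F j.2 x) ->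
  bijective (triv (whitney_sum E F) j x).
Proof.
move=> [g gK Kg] [h hK Kh].
exists (fun v => (g (lsubmx v), h (rsubmx v))) => [e|v].
  by rewrite whitney_trivE row_mxKl row_mxKr gK hK -surjective_pairing.
by rewrite whitney_trivE /= Kg Kh hsubmxK.
Qed.

End LinearAlgebra.

(** * Transition maps and tangent vectors of a manifold *)

Section Manifold.
Context {R : realType} {n : nat} (M : charted_space R n).
Hypothesis (Mmfd : is_manifold M).

Lemma dom_chart_at (x : M) : dom (chart_at x) x.
Proof. by case: Mmfd => h _ _ _ _; exact: h. Qed.

Lemma chartK (i : chart_ix M) (x : M) : dom i x -> param i (chart i x) = x.
Proof. by case: Mmfd => _ h _ _ _; exact: h. Qed.

Lemma open_overlap (i j : chart_ix M) : open (chart i @` (dom i `&` dom j)).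
Proof. by case: Mmfd => _ _ /(_ i j)[]. Qed.

Lemma transition_diff (i j : chart_ix M) (x : M) : dom i x -> dom j x ->
  differentiable (chart j \o param i) (chart i x).
Proof.
move=> ix jx; case: Mmfd => _ _ /(_ i j)[_ sm] _ _.
by apply: Ck_diff (sm 1) _; exists x.
Qed.

(** The composite of the two transition maps is the identity on an open set around [chart i x], and
    the chain rule applies. *)
Lemma transition_diffK (i j : chart_ix M) (x : M) : dom i x -> dom j x ->
  cancel ('d (chart j \o param i) (chart i x))
         ('d (chart i \o param j) (chart j x)).
Proof.
move=> ix jx v.
have dij := transition_diff ix jx.
have jE : (chart j \o param i) (chart i x) = chart j x by rewrite /= (chartK ix).
have dji : differentiable (chart i \o param j) ((chart j \o param i) (chart i x)).
  by rewrite jE; exact: transition_diff.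
have Dx : (chart i @` (dom i `&` dom j)) (chart i x) by exists x.
have Did y : (chart i @` (dom i `&` dom j)) y ->
    id y = ((chart i \o param j) \o (chart j \o param i)) y.
  by move=> [x' [ix' jx'] <-] /=; rewrite (chartK ix') (chartK jx').
have di : differentiable (id : 'rV[R]_n -> 'rV[R]_n) (chart i x).
  by have [] := linear_rV_differentiable (L := id) (chart i x) (fun a u v => erefl).
have [_ dE] := near_eq_differentiable
  (near_open_eq (g := id) (@open_overlap i j) Dx Did) di.
have iE : 'd (id : 'rV[R]_n -> 'rV[R]_n) (chart i x) = id :> (_ -> _).
  by have [] := linear_rV_differentiable (L := id) (chart i x) (fun a u v => erefl).
have := etrans (esym (diff_comp dij dji)) (etrans dE iE).
by move=> /(congr1 (fun h : 'rV[R]_n -> 'rV[R]_n => h v)) /=; rewrite (chartK ix).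
Qed.

Lemma tangent_triv_bij (i : chart_ix M) (x : M) : dom i x ->
  bijective (triv (tangent_bundle M) i x).
Proof.
move=> ix; have ax := dom_chart_at x.
have trivE v : triv (tangent_bundle M) i x v =
    'd (chart i \o param (chart_at x) : 'rV[R]_n -> 'rV[R]_n)
      (chart (chart_at x) x) v.
  by rewrite /= linfun_linearE //; exact: linearP.
exists ('d (chart (chart_at x) \o param i : 'rV[R]_n -> 'rV[R]_n) (chart i x)) => v.
  by rewrite trivE; exact: transition_diffK.
by rewrite trivE; exact: transition_diffK.
Qed.

End Manifold.

(** Passes from coordinate curves to the curves that [tangent_to] asks for, namely
    [param (chart_at z) \o c]. *)
Lemma curve_tangent_to (R : realType) (n : nat) (P : charted_space R n)
    (S : set P) (z : P) (c : R^o -> 'rV[R]_n) (e : R) :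
  0 < e -> param (chart_at z) (c 0) = z ->
  (forall t, `|t| < e -> [/\ dom (chart_at z) (param (chart_at z) (c t)),
     chart (chart_at z) (param (chart_at z) (c t)) = c t
   & S (param (chart_at z) (c t))]) ->
  smooth_on [set t : R^o | `|t| < e] c -> tangent_to S z ('D_1 c 0).
Proof.
move=> e0 c0 cP smc.
have oD : open [set t : R^o | `|t| < e].
  have -> : [set t : R^o | `|t| < e] = ball (0 : R^o) e; last exact: ball_open.
  by apply/seteqP; split=> t; rewrite -ball_normE /= sub0r normrN.
have D0 : [set t : R^o | `|t| < e] 0 by rewrite /= normr0.
exists (param (chart_at z) \o c), e; split=> //.
- by move=> t te; have [] := cP t te.
- move=> k; apply: Ck_eq (smc k) => // t te.
  by have [] := cP t te.
- apply/esym; apply: near_eq_derive; apply: near_open_eq oD D0 _ => t te.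
  by have [] := cP t te.
Qed.

(** * The adjoint system *)

Section AdjointSpace.
Context {R : realType} {n m r : nat}.
Variables (Md : charted_space R n) (Ma : charted_space R m).
Variables (Phi : bundle (prod_space Md Ma) r).
Variables (f : section (pulled_tangent Md Ma)) (phi : section Phi).
Hypotheses (mfd_d : is_manifold Md) (mfd_a : is_manifold Ma).
Hypotheses (vbPhi : is_vbundle Phi).
Hypotheses (smf : smooth_section f) (smphi : smooth_section phi).

Local Notation base := (prod_space Md Ma).
Local Notation total := (adjoint_space Phi).
Local Notation cot := (dual_bundle (tangent_bundle Md)).
Local Notation N := (n + m + (n + r))%N.

(** The chart of [Md] also trivializes the cotangent factor, so that p has canonical components. The
    chosen charts [chart_at z] are of this form. *)
Definition total_ix (i : chart_ix base) (j : triv_ix Phi) : chart_ix total :=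
  (i, (i.1, j)).

Definition base_dom (i : chart_ix base) (j : triv_ix Phi) : set 'rV[R]_(n + m) :=
  chart i @` (dom i `&` tdom Phi j).

Definition local_f (i : chart_ix base) (y : 'rV[R]_(n + m)) : 'rV[R]_n :=
  triv (pulled_tangent Md Ma) i.1 (param i y) (f (param i y)).

Definition local_phi (i : chart_ix base) (j : triv_ix Phi)
    (y : 'rV[R]_(n + m)) : 'rV[R]_r :=
  triv Phi j (param i y) (phi (param i y)).

Lemma base_chartK (i : chart_ix base) (x : base) :
  dom i x -> param i (chart i x) = x.
Proof.
case: i x => i1 i2 [q u] [/= iq iu].
by rewrite row_mxKl row_mxKr (chartK mfd_d iq) (chartK mfd_a iu).
Qed.

Lemma base_dom_param i j y : base_dom i j y ->
  [/\ dom i (param i y), tdom Phi j (param i y) & chart i (param i y) = y].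
Proof. by move=> [x [ix jx] <-]; rewrite base_chartK. Qed.

Lemma open_base_dom i j : open (base_dom i j).
Proof. by case: vbPhi => _ /(_ j) + _ _; apply. Qed.

Lemma phi_triv_bij j x : tdom Phi j x -> bijective (triv Phi j x).
Proof. by case: vbPhi => _ _ h _; exact: h. Qed.

Lemma cot_triv_bij (i : chart_ix Md) (q : Md) :
  dom i q -> bijective (triv cot i q).
Proof. by move=> iq; apply: dual_triv_bij; exact: tangent_triv_bij. Qed.

Lemma fiber_triv_bij (i : chart_ix base) j (x : base) : dom i x -> tdom Phi j x ->
  bijective (triv (whitney_sum (pulled_cotangent Md Ma) (dual_bundle Phi))
    (i.1, j) x).
Proof.
move=> [iq _] jx; apply: whitney_triv_bij; first exact: (cot_triv_bij iq).
exact/dual_triv_bij/phi_triv_bij.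
Qed.

Lemma smooth_local_f i j : smooth_on (base_dom i j) (local_f i).
Proof.
move=> k; apply: Ck_subset (smf i i.1 k) => _ [x [ix _] <-].
by exists x => //; split=> //; case: ix.
Qed.

Lemma smooth_local_phi i j : smooth_on (base_dom i j) (local_phi i j).
Proof. exact: smphi. Qed.

Lemma total_chartE i j (z : total) :
  chart (total_ix i j) z = row_mx (chart i (projT1 z))
    (row_mx (triv cot i.1 (projT1 z).1 (projT2 z).1)
            (triv (dual_bundle Phi) j (projT1 z) (projT2 z).2)).
Proof.
exact: (congr1 (row_mx (chart i (projT1 z)))
  (whitney_trivE (E := pulled_cotangent Md Ma) (F := dual_bundle Phi)
     (i.1, j) (projT2 z))).
Qed.

Lemma total_paramK i j y : base_dom i j (lsubmx y) ->
  dom (total_ix i j) (param (total_ix i j) y) /\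
  chart (total_ix i j) (param (total_ix i j) y) = y.
Proof.
move=> /base_dom_param[ix jx cx]; split.
  by split=> //; split=> //; case: ix.
have [_ Kt] := bij_lfunK (fiber_triv_bij ix jx).
rewrite -[RHS]hsubmxK; congr row_mx; first exact: cx.
exact: Kt.
Qed.

Lemma total_chartK i j (z : total) : dom i (projT1 z) -> tdom Phi j (projT1 z) ->
  param (total_ix i j) (chart (total_ix i j) z) = z.
Proof.
case: z => x e ix jx.
pose W := whitney_sum (pulled_cotangent Md Ma) (dual_bundle Phi).
have [tK _] := bij_lfunK (fiber_triv_bij ix jx).
(* The fiber depends on the base point, so the equality of dependent pairs is proved for a variable
   [y], whose two halves can then be rewritten. *)
have aux y : lsubmx y = chart i x -> rsubmx y = triv W (i.1, j) x e ->
    param (total_ix i j) y = existT (fiber W) x e.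
  move=> ly ry; change (existT (fiber W) (param i (lsubmx y))
    (((triv W (i.1, j) (param i (lsubmx y)))^-1)%VF (rsubmx y)) = existT (fiber W) x e).
  by rewrite ly ry (base_chartK ix) tK.
by apply: aux; [exact: row_mxKl|exact: row_mxKr].
Qed.

Lemma base_dom_chart i j (z : total) :
  dom i (projT1 z) -> tdom Phi j (projT1 z) ->
  base_dom i j (lsubmx (chart (total_ix i j) z)).
Proof. by move=> ix jx; rewrite total_chartE row_mxKl; exists (projT1 z). Qed.

Lemma hamiltonianE i j (z : total) : dom i (projT1 z) -> tdom Phi j (projT1 z) ->
  adjoint_hamiltonian f phi z =
    local_ham (local_f i) (local_phi i j) (chart (total_ix i j) z).
Proof.
move=> ix jx; rewrite total_chartE local_ham_row /local_f /local_phi.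
rewrite (base_chartK ix); congr (_ + _).
  apply: (dual_pairing (E := tangent_bundle Md)).
  by apply: tangent_triv_bij => //; case: ix.
exact/dual_pairing/phi_triv_bij.
Qed.

Lemma hamiltonian_param i j y : base_dom i j (lsubmx y) ->
  local_ham (local_f i) (local_phi i j) y =
    adjoint_hamiltonian f phi (param (total_ix i j) y).
Proof.
move=> Uy; have [ix jx _] := base_dom_param Uy.
by have [_ cK] := total_paramK Uy; rewrite (@hamiltonianE i j) ?cK.
Qed.

Definition chart0 (z : total) : chart_ix base := chart_at (projT1 z).
Definition triv0 (z : total) : triv_ix Phi := triv_at Phi (projT1 z).

Lemma dom0 z : dom (chart0 z) (projT1 z).
Proof. by split; exact: dom_chart_at. Qed.

Lemma tdom0 z : tdom Phi (triv0 z) (projT1 z).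
Proof. by case: vbPhi => h _ _ _; exact: h. Qed.

(** In the chosen charts [to_cotangent] is the linear map (q, u, p, lambda) |-> (q, p), which is its
    own differential. *)
Lemma Omega0E z (Z W : tangent_space z) :
  Omega0 Phi z Z W =
  \sum_(i < n) ((lsubmx (lsubmx (Z : 'rV[R]_N)) 0 i * lsubmx (rsubmx (W : 'rV[R]_N)) 0 i -
    lsubmx (lsubmx (W : 'rV[R]_N)) 0 i * lsubmx (rsubmx (Z : 'rV[R]_N)) 0 i) : R).
Proof.
pose g (y : 'rV[R]_N) : 'rV[R]_(n + n) :=
  row_mx (lsubmx (lsubmx y)) (lsubmx (rsubmx y)).
have ling : linear g.
  by move=> a u v; rewrite /g !linearP /= scale_row_mx add_row_mx.
have gE y : (lsubmx @^-1` base_dom (chart0 z) (triv0 z)) y ->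
    g y = (chart (chart_at (to_cotangent z)) \o @to_cotangent R n m r Md Ma Phi \o
           param (chart_at z)) y.
  move=> Uy; have [_ /esym] := total_paramK Uy.
  rewrite total_chartE {1}/g => yE; rewrite [in LHS]yE.
  by rewrite row_mxKl row_mxKr !row_mxKl.
have oU : open (lsubmx @^-1` base_dom (chart0 z) (triv0 z) : set 'rV[R]_N).
  by apply: open_local; exact: open_base_dom.
have Uz := base_dom_chart (dom0 z) (tdom0 z).
have [dg gdE] := linear_rV_differentiable (chart (chart_at z) z) ling.
have [_ dE] := near_eq_differentiable (near_open_eq oU Uz gE) dg.
have mE v : mdiff (@to_cotangent R n m r Md Ma Phi) z v = g v.
  by rewrite /mdiff dE gdE.
rewrite /Omega0 /pullback_form /canonical_form !mE /g.
by apply: eq_bigr => i _; rewrite !row_mxKl !row_mxKr.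
Qed.

(** * The first constraint set and its independence of the chart *)

Local Notation w := (Omega0 Phi).
Local Notation H := (adjoint_hamiltonian f phi).
Local Notation "'P1'" := (constraint_set w H 1).

Definition local_K (i : chart_ix base) (j : triv_ix Phi) : 'rV[R]_N -> 'rV[R]_(r + m) :=
  local_constraint (local_f i) (local_phi i j).

Let O (i : chart_ix base) (j : triv_ix Phi) : set 'rV[R]_N :=
  lsubmx @^-1` base_dom i j.

Let oO i j : open (O i j).
Proof. by apply: open_local; exact: open_base_dom. Qed.

Let Oz (z : total) : O (chart0 z) (triv0 z) (chart (chart_at z) z).
Proof. by apply: base_dom_chart; [exact: dom0|exact: tdom0]. Qed.

(** A straight line in coordinates stays in the open range of the chart for small times. *)
Lemma tangent_to_setT (z : total) (Z : tangent_space z) : tangent_to setT z Z.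
Proof.
pose y := chart (chart_at z) z.
have nO : \forall t \near (0 : R^o), O (chart0 z) (triv0 z) (y + t *: (Z : 'rV[R]_N)).
  have cl : {for 0, continuous (fun t : R^o => y + t *: (Z : 'rV[R]_N))}.
    by apply: differentiable_continuous; exact: differentiable_line.
  apply: cl; rewrite scale0r addr0; apply: open_nbhs_nbhs; split; [exact: oO|exact: Oz].
have [e /= e0 eO] := (nbhs_ballP _ _).1 nO.
have zE : param (chart_at z) y = z.
  exact: (total_chartK (dom0 z) (tdom0 z)).
have := @curve_tangent_to R _ total setT z (fun t : R^o => y + t *: (Z : 'rV[R]_N)) e e0.
rewrite derive_line !scale1r scale0r addr0; apply => //.
- move=> t te; have /eO Ot : ball (0 : R^o) e t by rewrite -ball_normE /= sub0r normrN.
  by have [d c] := total_paramK Ot; split.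
- exact: smooth_line.
Qed.

(** Nondegeneracy of the canonical form: pairing with a W that has a single nonzero (q, p)-component
    kills the conjugate component of Z. The set [S] will be the whole space and then P_1. *)
Lemma ker_form_vert (S : set total) (z : total) (Z : tangent_space z) :
  (forall q p : 'rV[R]_n, exists W : tangent_space z,
    [/\ tangent_to S z W, lsubmx (lsubmx (W : 'rV[R]_N)) = q
      & lsubmx (rsubmx (W : 'rV[R]_N)) = p]) ->
  ker_form w S z Z ->
  Z = vert n (rsubmx (lsubmx (Z : 'rV[R]_N))) (rsubmx (rsubmx (Z : 'rV[R]_N))).
Proof.
move=> full [_ kerZ].
have q0 : lsubmx (lsubmx (Z : 'rV[R]_N)) = 0.
  apply/rowP => i; have [W [tW Wq Wp]] := full 0 (delta_mx 0 i).
  have := kerZ W tW; rewrite Omega0E Wq Wp (bigD1 i) //= big1.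
    by rewrite !mxE !eqxx mulr1 mul0r subr0 addr0.
  by move=> k ki; rewrite !mxE (negPf ki) andbF mulr0 mul0r subr0.
have p0 : lsubmx (rsubmx (Z : 'rV[R]_N)) = 0.
  apply/rowP => i; have [W [tW Wq Wp]] := full (delta_mx 0 i) 0.
  have := kerZ W tW; rewrite Omega0E Wq Wp (bigD1 i) //= big1.
    rewrite !mxE !eqxx mulr0 mul1r sub0r addr0 => /eqP.
    by rewrite oppr_eq0 => /eqP.
  by move=> k ki; rewrite !mxE (negPf ki) andbF mulr0 mul0r subr0.
by rewrite /vert -{1}q0 -p0 !hsubmxK.
Qed.

Lemma dfun_local (z : total) (Z : tangent_space z) :
  dfun H z Z =
  'd (local_ham (local_f (chart0 z)) (local_phi (chart0 z) (triv0 z)))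
    (chart (chart_at z) z) Z.
Proof.
have dh := differentiable_local_ham (@open_base_dom (chart0 z) (triv0 z))
  (smooth_local_f (chart0 z) (triv0 z))
  (smooth_local_phi (chart0 z) (triv0 z)) (Oz z).
have hE y : O (chart0 z) (triv0 z) y ->
    local_ham (local_f (chart0 z)) (local_phi (chart0 z) (triv0 z)) y =
    (H \o param (chart_at z)) y.
  exact: hamiltonian_param.
have [_ dE] := near_eq_differentiable (near_open_eq (@oO _ _) (Oz z) hE) dh.
by rewrite /dfun dE.
Qed.

Lemma ham_constraint_eq0 i j y : O i j y ->
  local_K i j y = 0 <->
  forall a b, 'd (local_ham (local_f i) (local_phi i j)) y (vert n a b) = 0.
Proof.
apply: local_constraint_eq0; [exact: open_base_dom|exact: smooth_local_f|].
exact: smooth_local_phi.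
Qed.

(** All vectors are tangent to P_0, so the kernel there consists of the vertical vectors, and Z(H) =
    0 on these amounts to K = 0. *)
Lemma constraint1_chart0 (z : total) :
  P1 z <-> local_K (chart0 z) (triv0 z) (chart (chart_at z) z) = 0.
Proof.
have K0P := ham_constraint_eq0 (Oz z); split=> [[_ kerH]|/K0P K0].
  apply/K0P => a b; rewrite -dfun_local; apply: kerH; split.
    exact: tangent_to_setT.
  move=> W _; rewrite Omega0E big1 // => i _.
  by rewrite /vert row_mxKl row_mxKr !row_mxKl !mxE mulr0 mul0r subr0.
split=> // Z kerZ; rewrite dfun_local (ker_form_vert _ kerZ) // => q p.
exists (row_mx (row_mx q 0) (row_mx p 0)); split; first exact: tangent_to_setT.
  by rewrite !row_mxKl.
by rewrite row_mxKr row_mxKl.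
Qed.

(* For fixed [q], [p] and [lambda], the Hamiltonian is a function of [u] alone;
   [lambda] is transported along [u] by keeping its components in the
   trivialization [j] constant. *)
Definition fiber_ham (z : total) (i2 : chart_ix Ma) (j : triv_ix Phi)
    (v : 'rV[R]_m) : R^o :=
  ((projT2 z).1 : 'Hom(_, R^o)) (f ((projT1 z).1, param i2 v)) +
  \sum_(A < r) triv (dual_bundle Phi) j (projT1 z) (projT2 z).2 0 A *
    triv Phi j ((projT1 z).1, param i2 v) (phi ((projT1 z).1, param i2 v)) 0 A.

Lemma param_row (i : chart_ix base) (q : Md) (v : 'rV[R]_m) : dom i.1 q ->
  param i (row_mx (chart i.1 q) v) = (q, param i.2 v).
Proof.
by move=> iq; rewrite /= row_mxKl row_mxKr (chartK mfd_d iq).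
Qed.

Lemma fiber_hamE (z : total) (i : chart_ix base) j (v : 'rV[R]_m) :
  dom i (projT1 z) ->
  local_ham (local_f i) (local_phi i j)
    (row_mx (row_mx (chart i.1 (projT1 z).1) v)
       (row_mx (triv cot i.1 (projT1 z).1 (projT2 z).1)
               (triv (dual_bundle Phi) j (projT1 z) (projT2 z).2))) =
  fiber_ham z i.2 j v.
Proof.
move=> [iq iu]; rewrite local_ham_row /local_f /local_phi (param_row v iq).
rewrite /fiber_ham; congr (_ + _); apply/esym.
apply: (dual_pairing (E := tangent_bundle Md)).
exact: tangent_triv_bij.
Qed.

Lemma total_chart_row i j (z : total) :
  chart (total_ix i j) z =
    row_mx (row_mx (chart i.1 (projT1 z).1) (chart i.2 (projT1 z).2))
      (row_mx (triv cot i.1 (projT1 z).1 (projT2 z).1)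
              (triv (dual_bundle Phi) j (projT1 z) (projT2 z).2)).
Proof. exact: total_chartE. Qed.

Lemma derive_fiber_ham (z : total) i j (a : 'rV[R]_m) : dom i (projT1 z) ->
  'D_(vert n a 0) (local_ham (local_f i) (local_phi i j))
      (chart (total_ix i j) z) =
    'D_a (fiber_ham z i.2 j) (chart i.2 (projT1 z).2).
Proof.
move=> ix; apply: derive_slice => t; rewrite -(fiber_hamE _ _ ix) total_chart_row.
by rewrite /vert !scale_row_mx !add_row_mx !scaler0 !add0r.
Qed.

Lemma differentiable_fiber_ham (z : total) i j : dom i (projT1 z) ->
  tdom Phi j (projT1 z) ->
  differentiable (fiber_ham z i.2 j) (chart i.2 (projT1 z).2).
Proof.
move=> ix jx; set u0 := chart i.2 _.
pose C := row_mx (triv cot i.1 (projT1 z).1 (projT2 z).1)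
               (triv (dual_bundle Phi) j (projT1 z) (projT2 z).2).
pose a v := vert n (v : 'rV[R]_m) (0 : 'rV[R]_r).
have lina : linear a.
  by move=> t v v'; rewrite /a /vert !(scale_row_mx, add_row_mx) !scaler0 !add0r.
pose d : 'rV[R]_N := row_mx (row_mx (chart i.1 (projT1 z).1) 0) C.
pose b v := a v + d.
have bE v : b v = row_mx (row_mx (chart i.1 (projT1 z).1) v) C.
  by rewrite /b /a /d /vert row_mx0 !add_row_mx !add0r addr0.
have db : differentiable b u0.
  apply: (@differentiableD _ _ _ a (cst d)) => //.
  by have [] := linear_rV_differentiable u0 lina.
have -> : fiber_ham z i.2 j = (local_ham (local_f i) (local_phi i j) \o b).
  by apply/funext => v; rewrite -(fiber_hamE _ _ ix) /comp bE.
have bu : b u0 = chart (total_ix i j) z by rewrite bE total_chart_row.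
apply: differentiable_comp => //; rewrite bu.
apply: (differentiable_local_ham (@open_base_dom i j)).
- exact: smooth_local_f.
- exact: smooth_local_phi.
- exact: base_dom_chart.
Qed.

(** The right-hand side no longer involves the chart of [Md]; only the dependence on [i.2] and on
    [j] remains to be removed. *)
Lemma local_K_eq0P (z : total) i j : dom i (projT1 z) -> tdom Phi j (projT1 z) ->
  local_K i j (chart (total_ix i j) z) = 0 <->
  phi (projT1 z) = 0 /\
  forall a, 'D_a (fiber_ham z i.2 j) (chart i.2 (projT1 z).2) = 0.
Proof.
move=> ix jx; have Bz := base_dom_chart ix jx.
have GE : local_phi i j (lsubmx (chart (total_ix i j) z)) =
    triv Phi j (projT1 z) (phi (projT1 z)).
  by rewrite total_chartE row_mxKl /local_phi (base_chartK ix).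
split=> [K0|[phi0 D0]].
  split.
    have := congr1 lsubmx K0; rewrite /local_K /local_constraint row_mxKl linear0.
    rewrite GE => t0; have [g tK _] := phi_triv_bij jx.
    by rewrite -[LHS]tK t0 -[RHS]tK linear0.
  move=> a; rewrite -(derive_fiber_ham _ _ ix).
  have dh : differentiable (local_ham (local_f i) (local_phi i j))
      (chart (total_ix i j) z).
    apply: (differentiable_local_ham (@open_base_dom i j)).
    - exact: smooth_local_f.
    - exact: smooth_local_phi.
    - by [].
  rewrite (deriveE _ dh).
  by have [h _] := ham_constraint_eq0 Bz; apply: h.
apply/rowP => k; rewrite [RHS]mxE; case: (split_ordP k) => l ->.
  by rewrite row_mxEl GE phi0 linear0 mxE.
by rewrite row_mxEr mxE (derive_fiber_ham _ _ ix).
Qed.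

(** Being a critical point does not depend on the coordinates, by the chain rule for the transition
    map [tau]. *)
Lemma fiber_ham_chart_change (z : total) (i1 : chart_ix Md) (i2 i2' : chart_ix Ma) j :
  dom i1 (projT1 z).1 -> dom i2 (projT1 z).2 -> dom i2' (projT1 z).2 ->
  tdom Phi j (projT1 z) ->
  (forall a, 'D_a (fiber_ham z i2 j) (chart i2 (projT1 z).2) = 0) ->
  forall a, 'D_a (fiber_ham z i2' j) (chart i2' (projT1 z).2) = 0.
Proof.
set u := (projT1 z).2 => iq iu iu' jx D0 a.
pose tau := chart i2 \o param i2' : 'rV[R]_m -> 'rV[R]_m.
have tauu : tau (chart i2' u) = chart i2 u by rewrite /tau /= (chartK mfd_a iu').
have dtau : differentiable tau (chart i2' u) by exact: transition_diff.
have dk : differentiable (fiber_ham z i2 j) (tau (chart i2' u)).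
  by rewrite tauu; exact: (@differentiable_fiber_ham z (i1, i2)).
have Du : (chart i2' @` (dom i2' `&` dom i2)) (chart i2' u) by exists u.
have kE v : (chart i2' @` (dom i2' `&` dom i2)) v ->
    fiber_ham z i2' j v = fiber_ham z i2 j (tau v).
  move=> [u' [iu1 iu2] <-]; rewrite /fiber_ham /tau /=.
  by rewrite (chartK mfd_a iu1) (chartK mfd_a iu2).
rewrite (near_eq_derive _ (near_open_eq (@open_overlap _ _ _ mfd_a i2' i2) Du kE)).
rewrite (derive_comp _ dtau dk) (diff_rV_sum _ dk) big1 // => l _.
by rewrite tauu D0 scaler0.
Qed.

(* Change of trivialization of [Phi]: the difference of the two functions is a
   sum of products of two factors that both vanish where [phi] does. *)
Lemma fiber_ham_triv_change (z : total) (i : chart_ix base) j j' (a : 'rV[R]_m) :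
  dom i (projT1 z) -> tdom Phi j (projT1 z) -> tdom Phi j' (projT1 z) ->
  phi (projT1 z) = 0 ->
  'D_a (fiber_ham z i.2 j') (chart i.2 (projT1 z).2) =
  'D_a (fiber_ham z i.2 j) (chart i.2 (projT1 z).2).
Proof.
set x := projT1 z; set l := (projT2 z).2 => ix jx jx' phi0.
have iq : dom i.1 x.1 by case: ix.
pose q0 := chart i.1 x.1; pose u0 := chart i.2 x.2.
pose G B (v : 'rV[R]_m) : R^o := local_phi i j (row_mx q0 v) 0 B.
pose L A := triv (dual_bundle Phi) j x l 0 A.
pose L' A := triv (dual_bundle Phi) j' x l 0 A.
pose T B y := triv Phi j' (param i y) (((triv Phi j (param i y))^-1)%VF (delta_mx 0 B)).
(* [t B] is the component in [j] of the covector whose components in [j'] are frozen; at [u0] it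
   equals [L B]. *)
pose t B (v : 'rV[R]_m) : R^o := \sum_(A < r) L' A * T B (row_mx q0 v) 0 A.
pose U := chart i @` (dom i `&` (tdom Phi j `&` tdom Phi j')).
have Ux : U (row_mx q0 u0) by exists x.
have oU : open U.
  have -> : U = base_dom i j `&` base_dom i j'.
    apply/seteqP; split=> [_ [y [iy [jy jy']] <-]|y]; first by split; exists y.
    move=> [/(base_dom_param)[iy jy cy]].
    move=> /(base_dom_param)[_ jy' _].
    by exists (param i y).
  by apply: openI; exact: open_base_dom.
have smT B : smooth_on U (T B).
  by case: vbPhi => _ _ _ /(_ i j j' (delta_mx 0 B)).
have dG B : differentiable (G B) u0.
  apply: (@differentiable_row R n m R^o (fun y => local_phi i j y 0 B : R^o)).
  have Bx : base_dom i j (row_mx q0 u0) by exists x.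
  have := Ck_diff (smooth_local_phi i j 1) Bx.
  by move=> /differentiable_rVP; apply.
have dt B : differentiable (t B) u0.
  apply: (@differentiable_row R n m R^o (fun y => \sum_(A < r) L' A * T B y 0 A : R^o)).
  apply: (@Ck_diff _ _ _ U _ 0) => //.
  apply: Ck_sum => // A; apply: Ck_mul => //; first exact: Ck_cst.
  exact: (Ck_rVP _ _ oU).1 (smT B 1) A.
have Gu0 B : G B u0 = 0.
  rewrite /G /local_phi (param_row _ iq) /u0.
  have -> : (x.1, param i.2 (chart i.2 x.2)) = x.
    by case: ix => _ iu; rewrite (chartK mfd_a iu) -surjective_pairing.
  by rewrite phi0 linear0 mxE.
have tu0 B : t B u0 = L B.
  rewrite /t /T (param_row _ iq) /u0.
  have -> : (x.1, param i.2 (chart i.2 x.2)) = x.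
    by case: ix => _ iu; rewrite (chartK mfd_a iu) -surjective_pairing.
  rewrite -(dual_pairing _ _ (phi_triv_bij jx')).
  by rewrite /L dual_trivE mxE.
pose V := (fun v : 'rV[R]_m => row_mx q0 v) @^-1` U.
have oV : open V.
  apply: open_comp => // v _; apply: differentiable_continuous.
  exact: (@differentiable_row R n m 'rV[R]_(n + m) id).
pose P B : 'rV[R]_m -> R^o := G B * (t B - cst (L B)).
have fE v : V v -> fiber_ham z i.2 j' v = (fiber_ham z i.2 j + \sum_B P B) v.
  move=> [x' [ix' [jx1 jx2]] x'E].
  have pE : (x.1, param i.2 v) = x'.
    by rewrite -(param_row _ iq) -x'E (base_chartK ix').
  rewrite !fctE fct_sumE /fiber_ham -addrA; congr (_ + _).
  rewrite -/x -/l pE -big_split /=.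
  (* phi is expanded in the frame of [j], and each frame vector is read in [j']. *)
  have -> : triv Phi j' x' (phi x') =
      \sum_(B < r) triv Phi j x' (phi x') 0 B *:
        triv Phi j' x' (((triv Phi j x')^-1)%VF (delta_mx 0 B)).
    have [tK _] := bij_lfunK (phi_triv_bij jx1).
    rewrite -[in LHS](tK (phi x')) [in LHS](row_sum_delta (triv Phi j x' (phi x'))).
    by rewrite !linear_sum; apply: eq_bigr => B _; rewrite !linearZ.
  transitivity (\sum_(B < r) G B v * t B v).
    rewrite /t; under [RHS]eq_bigr do rewrite mulr_sumr.
    rewrite [RHS]exchange_big /=; apply: eq_bigr => A _.
    rewrite summxE mulr_sumr; apply: eq_bigr => B _.
    rewrite mxE /G /local_phi /T (param_row _ iq) pE /L'; ring.
  apply: eq_bigr => B _; rewrite /P !fctE /L /G /local_phi (param_row _ iq) pE.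
  by rewrite mulrBr mulrC [X in _ - X]mulrC addrC subrK mulrC.
rewrite (near_eq_derive _ (near_open_eq oV Ux fE)).
have dk := differentiable_fiber_ham ix jx.
have dPt B : differentiable (t B - cst (L B)) u0 by exact: differentiableB.
have dP B : derivable (P B) u0 a.
  by apply: derivableM; apply: diff_derivable; [exact: dG|exact: dPt].
rewrite (deriveD (diff_derivable dk) (derivable_sum dP)) (derive_sum dP) big1 ?addr0 //.
move=> B _; rewrite (deriveM (diff_derivable (dG B)) (diff_derivable (dPt B))).
by rewrite !fctE Gu0 tu0 subrr !scale0r addr0.
Qed.

Lemma local_K_chart_change (z : total) i i' j j' :
  dom i (projT1 z) -> dom i' (projT1 z) ->
  tdom Phi j (projT1 z) -> tdom Phi j' (projT1 z) ->
  local_K i j (chart (total_ix i j) z) = 0 ->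
  local_K i' j' (chart (total_ix i' j') z) = 0.
Proof.
move=> ix ix' jx jx' /(local_K_eq0P ix jx)[phi0 D0]; apply/local_K_eq0P => //.
split=> // a; rewrite (fiber_ham_triv_change a ix' jx jx' phi0).
case: ix' => _ iu'; case: ix => iq iu.
exact: (fiber_ham_chart_change iq iu iu' jx D0).
Qed.

(** * Termination of the algorithm for index one *)

Hypotheses (dim_Ma : (1 <= m)%N) (index1 : index_one phi).

Let cK i j y : O i j y ->
  [/\ dom i (projT1 (param (total_ix i j) y)),
      tdom Phi j (projT1 (param (total_ix i j) y))
    & chart (total_ix i j) (param (total_ix i j) y) = y].
Proof.
move=> Oy; have [_ c] := total_paramK Oy.
by have [ix jx _] := base_dom_param Oy.
Qed.

Lemma constraint1P (z : total) i j : dom i (projT1 z) -> tdom Phi j (projT1 z) ->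
  P1 z <-> local_K i j (chart (total_ix i j) z) = 0.
Proof.
move=> ix jx; have d0 := dom0 z; have t0 := tdom0 z.
apply: iff_trans (constraint1_chart0 z) _.
by split; exact: (local_K_chart_change).
Qed.

Lemma constraint1_param i j y : O i j y ->
  P1 (param (total_ix i j) y) <-> local_K i j y = 0.
Proof.
by move=> /cK[ix jx cE]; have := constraint1P ix jx; rewrite cE.
Qed.

Let jacobian_inv (z : total) i j : dom i (projT1 z) -> tdom Phi j (projT1 z) ->
  phi (projT1 z) = 0 -> exists B : 'M[R]_(m, r),
  local_jacobian (local_phi i j) (lsubmx (chart (total_ix i j) z)) *m B = 1%:M /\
  B *m local_jacobian (local_phi i j) (lsubmx (chart (total_ix i j) z)) = 1%:M.
Proof.
move=> ix jx phi0; have [B BJ] := index1 phi0 ix jx; exists B.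
by rewrite total_chartE row_mxKl.
Qed.

Let P1_phi (z : total) : P1 z -> phi (projT1 z) = 0.
Proof.
have d0 := dom0 z; have t0 := tdom0 z.
move=> /(constraint1P d0 t0) K0.
by have [+ _] := local_K_eq0P d0 t0; case.
Qed.

Lemma embedded_submanifold_setT : embedded_submanifold (setT : set total).
Proof.
exists 0%N => z _; exists (O (chart0 z) (triv0 z)), (fun _ => 0); split.
- exact: oO.
- split; first exact: Oz.
  move=> y Oy; exists (param (chart_at z) y);
  by have [] := total_paramK Oy.
- by move=> k; exact: Ck_cst.
- by move=> y _ v; exists 0; rewrite [RHS]thinmx0 [LHS]thinmx0.
- by [].
Qed.

(** K is the defining map, of codimension r + m. It has to be a submersion on a whole neighbourhood,
    also off P_1, hence the restriction to a set [U] where the Jacobian stays invertible. *)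
Lemma embedded_submanifold_constraint1 : embedded_submanifold P1.
Proof.
exists (r + m)%N => z P1z.
have d0 := dom0 z; have t0 := tdom0 z.
have [B [JB BJ]] := jacobian_inv d0 t0 (P1_phi P1z).
have [U [oU Uz UO invU]] := local_jacobian_near
  (@open_base_dom (chart0 z) (triv0 z))
  (smooth_local_phi (chart0 z) (triv0 z)) (Oz z) JB BJ.
have smK := smooth_local_constraint
  (@open_base_dom (chart0 z) (triv0 z))
  (smooth_local_f (chart0 z) (triv0 z))
  (smooth_local_phi (chart0 z) (triv0 z)).
exists (lsubmx @^-1` U), (local_K (chart0 z) (triv0 z)); split.
- exact: open_local.
- split=> [//|y /UO Oy]; exists (param (chart_at z) y);
  by have [] := total_paramK Oy.
- move=> k; apply: Ck_subset (smK k) => y; exact: UO.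
- move=> y Uy v; have [Br [Bl [JBr BlJ]]] := invU _ Uy.
  have [a [b abE]] := diff_local_constraint_surj
    (@open_base_dom (chart0 z) (triv0 z))
    (smooth_local_f (chart0 z) (triv0 z))
    (smooth_local_phi (chart0 z) (triv0 z)) (UO _ Uy) JBr BlJ v.
  by exists (vert n a b).
- by move=> y Uy; apply: (constraint1_param (UO _ Uy)).
Qed.

Lemma constraint2E : constraint_set w H 2 = P1.
Proof.
apply/seteqP; split=> [z []//|z P1z]; split=> // Z kerZ.
have d0 := dom0 z; have t0 := tdom0 z.
have Kz : local_K (chart0 z) (triv0 z) (chart (chart_at z) z) = 0.
  exact/constraint1_chart0.
have [B [JB BJ]] := jacobian_inv d0 t0 (P1_phi P1z).
(* This is the hypothesis of [ker_form_vert] for P_1, supplied by curves in P_1 with prescribed (q,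
   p)-velocity. *)
have full (q p : 'rV[R]_n) : exists W : tangent_space z,
    [/\ tangent_to P1 z W, lsubmx (lsubmx (W : 'rV[R]_N)) = q
      & lsubmx (rsubmx (W : 'rV[R]_N)) = p].
  have [v [c [e [[e0 c0 cO smc Dc] [vq vp]]]]] := local_curve
    (@open_base_dom (chart0 z) (triv0 z))
    (smooth_local_f (chart0 z) (triv0 z))
    (smooth_local_phi (chart0 z) (triv0 z)) q p (Oz z) JB BJ Kz.
  exists v; split; [rewrite -Dc|exact: vq|exact: vp].
  apply: (@curve_tangent_to R _ total P1 z c e e0 _ _ smc).
    by rewrite c0; exact: total_chartK.
  move=> t te; have [Oc Kc] := cO t te.
  have [dc cc] := total_paramK Oc.
  split; [exact: dc|exact: cc|].
  exact: (constraint1_param Oc).2 Kc.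
rewrite (dfun_local).
rewrite (ker_form_vert full kerZ).
exact: (ham_constraint_eq0 (Oz z)).1.
Qed.

(** Each set is determined by the preceding one, so P_2 = P_1 propagates to all later steps. *)
Lemma constraint_setS k : constraint_set w H k.+1 = P1.
Proof.
elim: k => [//|k IH]; rewrite -[RHS]constraint2E.
by rewrite -[LHS]/([set z | constraint_set w H k.+1 z /\
  forall Z, ker_form w (constraint_set w H k.+1) z Z -> dfun H z Z = 0]) IH.
Qed.

(** If P_1 were everything, phi would vanish at [x] and the Jacobian J would be invertible there. At
    p = 0 the u-part of K is lambda J, which cannot vanish for every lambda. *)
Lemma constraint1_proper (x : base) : constraint_set w H 0 <> P1.
Proof.
move=> P1T; have P1z (z : total) : P1 z by rewrite -P1T.
pose i : chart_ix base := chart_at x; pose j : triv_ix Phi := triv_at Phi x.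
have ix : dom i x by split; exact: dom_chart_at.
have jx : tdom Phi j x by case: vbPhi => h _ _ _; exact: h.
pose y (l : 'rV[R]_r) : 'rV[R]_N := row_mx (chart i x) (row_mx 0 l).
have Oy l : O i j (y l) by rewrite /O /preimage /= row_mxKl; exists x.
have phi0 : phi x = 0.
  have := P1_phi (P1z (param (total_ix i j) (y 0))).
  have -> // : projT1 (param (total_ix i j) (y 0)) = x.
  by rewrite -[RHS](base_chartK ix) -[chart i x](row_mxKl _ (row_mx 0 (0 : 'rV[R]_r) : 'rV[R]_(n + r))).
have [B [_ BJ]] := index1 phi0 ix jx.
(* The index [a] exists because M_a has positive dimension; with this [l], the product l J is the
   basis vector of index [a]. *)
pose a := Ordinal dim_Ma; pose l := delta_mx 0 a *m B : 'rV[R]_r.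
have /(constraint1_param (Oy l)) Ky := P1z (param (total_ix i j) (y l)).
have := congr1 (fun v : 'rV_(r + m) => v 0 (rshift r a)) Ky.
rewrite /local_K (local_constraintE (@open_base_dom i j)
  (smooth_local_f i j) (smooth_local_phi i j)); last exact: Oy.
rewrite /y row_mxKr !row_mxKl row_mxKr big1 => [|k _]; last by rewrite mxE mul0r.
rewrite add0r /l -mulmxA.
rewrite -[local_jacobian _ _]/(constraint_jacobian phi i j x) BJ mulmx1 !mxE !eqxx.
by move=> /eqP; rewrite oner_eq0.
Qed.

End AdjointSpace.

Theorem mainTheorem2 (R : realType) (n m r : nat)
    (Md : charted_space R n) (Ma : charted_space R m)
    (Phi : bundle (prod_space Md Ma) r)
    (f : section (pulled_tangent Md Ma)) (phi : section Phi)
    (Md_manifold : is_manifold Md) (Ma_manifold : is_manifold Ma)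
    (Md_nonempty : inhabited Md) (Ma_nonempty : inhabited Ma)
    (Phi_vbundle : is_vbundle Phi)
    (f_smooth : smooth_section f) (phi_smooth : smooth_section phi)
    (dim_Ma : (1 <= m)%N) (index1 : index_one phi) :
  let Omega := Omega0 Phi in
  let H := adjoint_hamiltonian f phi in
  [/\ forall k, embedded_submanifold (constraint_set Omega H k),
      constraint_set Omega H 2 = constraint_set Omega H 1
    & is_nuP Omega H 1].
Proof.
move=> Omega H.
have P2 : constraint_set Omega H 2 = constraint_set Omega H 1 by exact: constraint2E.
split=> //.
  case=> [|k]; first exact: embedded_submanifold_setT.
  by rewrite /Omega /H constraint_setS //; exact: embedded_submanifold_constraint1.
split=> [|k]; first by rewrite P2.
rewrite ltnS leqn0 => /eqP ->.
(* A point of the base is what separates P_0 from P_1: over an empty base both would be empty. *)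
case: Md_nonempty Ma_nonempty => q [u].
exact: (constraint1_proper Md_manifold Ma_manifold Phi_vbundle f_smooth phi_smooth
  dim_Ma index1 (q, u)).
Qed.
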